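(* Let $\mu\in\mathcal P$. (i) For the inexact gradient $\widetilde\nabla_\mu\hat J_r(\mu)$ one has $$\|\nabla_\mu\hat{\mathcal J}_h(\mu)-\widetilde\nabla_\mu\hat J_r(\mu)\|_2\le\Delta_{\widetilde\nabla\hat J_r}(\mu)=\|\underline{\Delta_{\widetilde\nabla\hat J_r}(\mu)}\|_2,$$ where for $1\le i\le P$ $$\begin{aligned}(\underline{\Delta_{\widetilde\nabla\hat J_r}(\mu)})_i:={}&2\Delta_{\mathrm{pr}}(\mu)\|u_{r,\mu}\|\gamma_{d_{\mu_i}k_\mu}+\Delta_{\mathrm{pr}}(\mu)\big(\gamma_{d_{\mu_i}j_\mu}+\gamma_{d_{\mu_i}a_\mu}\|p_{r,\mu}\|\big)+\Delta_{\mathrm{du}}(\mu)\big(\gamma_{d_{\mu_i}l_\mu}+\gamma_{d_{\mu_i}a_\mu}\|u_{r,\mu}\|\big)\\&+\Delta_{\mathrm{pr}}(\mu)\Delta_{\mathrm{du}}(\mu)\gamma_{d_{\mu_i}a_\mu}+\Delta_{\mathrm{pr}}(\mu)^2\gamma_{d_{\mu_i}k_\mu}.\end{aligned}$$ (ii) For the gradient $\nabla_\mu\hat{\mathcal J}_r(\mu)$ of the NCD-corrected RB reduced functional, computed with the adjoint approach, one has $$\|\nabla_\mu\hat{\mathcal J}_h(\mu)-\nabla_\mu\hat{\mathcal J}_r(\mu)\|_2\le\Delta^*_{\nabla\hat{\mathcal J}_r}(\mu)=\|\underline{\Delta^*_{\nabla\hat{\mathcal J}_r}(\mu)}\|_2,$$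 where for $1\le i\le P$ $$\begin{aligned}(\underline{\Delta^*_{\nabla\hat{\mathcal J}_r}(\mu)})_i:={}&2\Delta_{\mathrm{pr}}(\mu)\|u_{r,\mu}\|\gamma_{d_{\mu_i}k_\mu}+\Delta_{\mathrm{pr}}(\mu)\big(\gamma_{d_{\mu_i}j_\mu}+\gamma_{d_{\mu_i}a_\mu}\|p_{r,\mu}\|\big)+\Delta_{\mathrm{du}}(\mu)\big(\gamma_{d_{\mu_i}l_\mu}+\gamma_{d_{\mu_i}a_\mu}\|u_{r,\mu}\|\big)\\&+\Delta_{\mathrm{pr}}(\mu)\Delta_{\mathrm{du}}(\mu)\gamma_{d_{\mu_i}a_\mu}+\Delta_{\mathrm{pr}}(\mu)^2\gamma_{d_{\mu_i}k_\mu}\\&+\big(\gamma_{d_{\mu_i}l_\mu}+\gamma_{d_{\mu_i}a_\mu}\|u_{r,\mu}\|\big)\,\underline{a_\mu}^{-1}\big(\|r^{\mathrm{du}}_\mu(u_{r,\mu},p_{r,\mu})\|+2\gamma_{k_\mu}\underline{a_\mu}^{-1}\|r^{\mathrm{pr}}_\mu(u_{r,\mu})\|\big)\\&+\underline{a_\mu}^{-1}\|r^{\mathrm{pr}}_\mu(u_{r,\mu})\|\big(\gamma_{d_{\mu_i}j_\mu}+2\gamma_{d_{\mu_i}k_\mu}\|u_{r,\mu}\|+\gamma_{d_{\mu_i}a_\mu}\|p_{r,\mu}\|\big).\end{aligned}$$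
   Context: Setting. Let $P\in\mathbb N$, $\mu_{\mathsf a},\mu_{\mathsf b}\in\mathbb R^P$, and $\mathcal P=\{\mu\in\mathbb R^P: \mu_{\mathsf a}\le\mu\le\mu_{\mathsf b}\}$ (componentwise). $V$ is a real Hilbert space with norm $\|\cdot\|$, and $V_h\subset V$ is a finite-dimensional subspace. For each $\mu\in\mathcal P$: $a_\mu:V\times V\to\mathbb R$ is a continuous, coercive, symmetric bilinear form; $l_\mu,j_\mu\in V'$; $k_\mu:V\times V\to\mathbb R$ is a continuous symmetric bilinear form; $\Theta:\mathcal P\to\mathbb R$. All forms are parameter separable, i.e. $a_\mu=\sum_{\xi}\theta^a_\xi(\mu)a_\xi$ is a finite sum with parameter-independent components, and similarly for $l_\mu,j_\mu,k_\mu$. The cost functional is $\mathcal J(u,\mu)=\Theta(\mu)+j_\mu(u)+k_\mu(u,u)$. It is assumed that $a_\mu,l_\mu,\mathcal J$ (hence all coefficient functions) are twice Fréchet differentiable with respect to $\mu$. Notation. $d_{\mu_i}$ is the partial derivative with respect to the $i$-th component of $\mu$; $d_{\mu_i}a_\mu,d_{\mu_i}l_\mu,d_{\mu_i}j_\mu,d_{\mu_i}k_\mu$ are the forms obtained by differentiating the coefficients; $d_{\mu_i}\mathcal J(u,\mu)$ is the partial derivative with $u$ held fixed. Residuals: $r^{\mathrm{pr}}_\mu(u)[v]=l_\mu(v)-a_\mu(u,v)$ and $r^{\mathrm{du}}_\mu(u,p)[v]=j_\mu(v)+2k_\mu(v,u)-a_\mu(v,p)$; $d_{\mu_i}r^{\mathrm{pr}}_\mu(u)[v]=d_{\mu_i}l_\mu(v)-d_{\mu_i}a_\mu(u,v)$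 and $d_{\mu_i}r^{\mathrm{du}}_\mu(u,p)[v]=d_{\mu_i}j_\mu(v)+2d_{\mu_i}k_\mu(v,u)-d_{\mu_i}a_\mu(v,p)$ (arguments $u,p,v$ held fixed, also when evaluated at $\mu$-dependent functions). Full order model. $u_{h,\mu}\in V_h$ solves $a_\mu(u_{h,\mu},v_h)=l_\mu(v_h)$ for all $v_h\in V_h$; $\hat{\mathcal J}_h(\mu)=\mathcal J(u_{h,\mu},\mu)$. Reduced basis (RB) model. Let $V_r^{\mathrm{pr}},V_r^{\mathrm{du}}\subset V_h$ be (possibly different) linear subspaces. $u_{r,\mu}\in V_r^{\mathrm{pr}}$ solves $a_\mu(u_{r,\mu},v_r)=l_\mu(v_r)$ for all $v_r\in V_r^{\mathrm{pr}}$; $p_{r,\mu}\in V_r^{\mathrm{du}}$ solves $a_\mu(q_r,p_{r,\mu})=j_\mu(q_r)+2k_\mu(q_r,u_{r,\mu})$ for all $q_r\in V_r^{\mathrm{du}}$. - Standard RB functional: $\hat J_r(\mu)=\mathcal J(u_{r,\mu},\mu)$, with inexact gradient $(\widetilde\nabla_\mu\hat J_r(\mu))_i:=d_{\mu_i}\mathcal J(u_{r,\mu},\mu)+d_{\mu_i}r^{\mathrm{pr}}_\mu(u_{r,\mu})[p_{r,\mu}]$. - NCD-corrected RB reduced functional: $\hat{\mathcal J}_r(\mu)=\mathcal J(u_{r,\mu},\mu)+r^{\mathrm{pr}}_\mu(u_{r,\mu})[p_{r,\mu}]$, whose true gradient is given by the adjoint approach as $(\nabla_\mu\hat{\mathcal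 J}_r(\mu))_i=d_{\mu_i}\mathcal J(u_{r,\mu},\mu)+d_{\mu_i}r^{\mathrm{pr}}_\mu(u_{r,\mu})[p_{r,\mu}+w_{r,\mu}]-d_{\mu_i}r^{\mathrm{du}}_\mu(u_{r,\mu},p_{r,\mu})[z_{r,\mu}]$, where $z_{r,\mu}\in V_r^{\mathrm{du}}$ solves $a_\mu(z_{r,\mu},q)=-r^{\mathrm{pr}}_\mu(u_{r,\mu})[q]$ for all $q\in V_r^{\mathrm{du}}$ and $w_{r,\mu}\in V_r^{\mathrm{pr}}$ solves $a_\mu(v,w_{r,\mu})=r^{\mathrm{du}}_\mu(u_{r,\mu},p_{r,\mu})[v]-2k_\mu(z_{r,\mu},v)$ for all $v\in V_r^{\mathrm{pr}}$. Norms and constants. Norms of residuals are dual norms in $V_h'$ with respect to $\|\cdot\|$; for a functional or bilinear form $b$ on $V_h$, $\gamma_b$ is its continuity constant (dual/operator norm); $\underline{a_\mu}>0$ is the coercivity constant of $a_\mu$ on $V_h$ with respect to $\|\cdot\|$. $\Delta_{\mathrm{pr}}(\mu)=\underline{a_\mu}^{-1}\|r^{\mathrm{pr}}_\mu(u_{r,\mu})\|$ and $\Delta_{\mathrm{du}}(\mu)=\underline{a_\mu}^{-1}\big(2\gamma_{k_\mu}\Delta_{\mathrm{pr}}(\mu)+\|r^{\mathrm{du}}_\mu(u_{r,\mu},p_{r,\mu})\|\big)$. $\|\cdot\|_2$ is the Euclidean norm on $\mathbb R^P$. *)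

(* Defs.v *)
From HB Require Import structures.
From mathcomp Require Import all_boot all_order all_algebra.
From mathcomp Require Import sesquilinear.
From mathcomp Require Import boolp classical_sets reals topology normedtype.
From mathcomp Require Import landau derive.

Set Implicit Arguments.
Unset Strict Implicit.
Unset Printing Implicit Defensive.

Import Order.TTheory GRing.Theory Num.Theory.
Import numFieldNormedType.Exports.

Local Open Scope classical_set_scope.
Local Open Scope ring_scope.

Section Calculus.
Variables (R : realType) (P : nat).
Implicit Types (mua mub mu : 'rV[R]_P) (f : 'rV[R]_P -> R) (i : 'I_P).

Definition box mua mub : set 'rV[R]_P :=
  [set mu | forall i, mua 0 i <= mu 0 i <= mub 0 i].

Definition enorm2 (x : 'rV[R]_P) : R := Num.sqrt (\sum_i x 0 i ^+ 2).

(* Partial derivative of a function whose values matter only on D: the limit of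
   the difference quotients along the increments h that keep mu + h e_i in D
   (two-sided in the interior of a box, one-sided on a face).  If D does not
   extend at all from mu in direction i (a box with mua_i = mub_i), there is no
   difference quotient and the value is 0. *)
Definition partial (D : set 'rV[R]_P) f i mu : R :=
  if `[< exists2 h : R, h != 0 & D (mu + h *: delta_mx 0 i) >] then
    lim ((fun h : R => h^-1 * (f (mu + h *: delta_mx 0 i) - f mu))
           @ within [set h | D (mu + h *: delta_mx 0 i)] (0 : R)^')
  else 0.

Definition gradient (D : set 'rV[R]_P) f mu : 'rV[R]_P :=
  \row_i partial D f i mu.

(* Frechet differentiability relative to D, at every point of D. *)
Definition differentiable_on (W : normedModType R) (D : set 'rV[R]_P)
    (F : 'rV[R]_P -> W) : Prop :=
  forall mu, D mu -> differentiable F (within D (nbhs mu)).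

Definition twice_differentiable_on (D : set 'rV[R]_P) f : Prop :=
  differentiable_on (W := R^o) D f /\ differentiable_on D (gradient D f).

End Calculus.

Section Subspaces.
Variables (R : realType) (V : normedModType R).
Implicit Types (W : set V) (phi : V -> R) (b : V -> V -> R).

Definition linear_subspace W : Prop := submod_closed [in W].

Definition finite_dim_subspace W : Prop :=
  exists (n : nat) (e : 'I_n -> V),
    W = [set v | exists c : 'I_n -> R, v = \sum_i c i *: e i].

Definition galerkin_solution W b phi (u : V) : Prop :=
  W u /\ forall v, W v -> b u v = phi v.

(* On W = {0} the three constants below are 0, because sup set0 = inf set0 = 0. *)
Definition dual_norm W phi : R :=
  sup [set `|phi v| / `|v| | v in [set v | W v /\ v != 0]].

Definition bilin_norm W b : R :=
  sup [set `|b w.1 w.2| / (`|w.1| * `|w.2|) |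
        w in [set w : V * V | (W w.1 /\ w.1 != 0) /\ (W w.2 /\ w.2 != 0)]].

Definition coercivity_constant W b : R :=
  inf [set b v v / `|v| ^+ 2 | v in [set v | W v /\ v != 0]].

Definition coercive b : Prop :=
  exists2 c : R, 0 < c & forall v, c * `|v| ^+ 2 <= b v v.

Definition symmetric_form b : Prop := forall u v, b u v = b v u.

Definition continuous_bilin b : Prop :=
  continuous (fun w : V * V => b w.1 w.2 : R^o).

End Subspaces.

Section Problem.
Variables (R : realType) (V : normedModType R) (P : nat).

(* A parameter separable form is sum_q coef_q (mu) comp_q; derivatives with
   respect to mu act on the coefficients only. *)
Record sep_linear := SepLinear {
  slin_size : nat;
  slin_coef : 'I_slin_size -> 'rV[R]_P -> R;
  slin_comp : 'I_slin_size -> {scalar V} }.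

Record sep_bilinear := SepBilinear {
  sbil_size : nat;
  sbil_coef : 'I_sbil_size -> 'rV[R]_P -> R;
  sbil_comp : 'I_sbil_size -> {biscalar V} }.

Definition slin (l : sep_linear) (mu : 'rV[R]_P) (v : V) : R :=
  \sum_q @slin_coef l q mu * @slin_comp l q v.

Definition sbil (b : sep_bilinear) (mu : 'rV[R]_P) (u v : V) : R :=
  \sum_q @sbil_coef b q mu * @sbil_comp b q u v.

Definition d_slin (D : set 'rV[R]_P) (l : sep_linear) i mu (v : V) : R :=
  \sum_q partial D (@slin_coef l q) i mu * @slin_comp l q v.

Definition d_sbil (D : set 'rV[R]_P) (b : sep_bilinear) i mu (u v : V) : R :=
  \sum_q partial D (@sbil_coef b q) i mu * @sbil_comp b q u v.

Record problem := Problem {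
  lower : 'rV[R]_P;
  upper : 'rV[R]_P;
  form_a : sep_bilinear;
  form_l : sep_linear;
  form_j : sep_linear;
  form_k : sep_bilinear;
  Theta : 'rV[R]_P -> R }.

Variable M : problem.
Implicit Types (mu : 'rV[R]_P) (i : 'I_P) (u v p z w : V).

Definition params : set 'rV[R]_P := box (lower M) (upper M).

Definition a_ mu u v : R := sbil (form_a M) mu u v.
Definition l_ mu v : R := slin (form_l M) mu v.
Definition j_ mu v : R := slin (form_j M) mu v.
Definition k_ mu u v : R := sbil (form_k M) mu u v.

Definition da_ i mu u v : R := d_sbil params (form_a M) i mu u v.
Definition dl_ i mu v : R := d_slin params (form_l M) i mu v.
Definition dj_ i mu v : R := d_slin params (form_j M) i mu v.
Definition dk_ i mu u v : R := d_sbil params (form_k M) i mu u v.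

Record standing_assumptions : Prop := StandingAssumptions {
  a_continuous : forall mu, params mu -> continuous_bilin (a_ mu);
  a_coercive : forall mu, params mu -> coercive (a_ mu);
  a_symmetric : forall mu, params mu -> symmetric_form (a_ mu);
  l_continuous : forall mu, params mu -> continuous (l_ mu : V -> R^o);
  j_continuous : forall mu, params mu -> continuous (j_ mu : V -> R^o);
  k_continuous : forall mu, params mu -> continuous_bilin (k_ mu);
  k_symmetric : forall mu, params mu -> symmetric_form (k_ mu);
  a_twice_diff : forall q, twice_differentiable_on params (@sbil_coef (form_a M) q);
  l_twice_diff : forall q, twice_differentiable_on params (@slin_coef (form_l M) q);
  j_twice_diff : forall q, twice_differentiable_on params (@slin_coef (form_j M) q);
  k_twice_diff : forall q, twice_differentiable_on params (@sbil_coef (form_k M) q);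
  Theta_twice_diff : twice_differentiable_on params (Theta M) }.

Definition cost u mu : R := Theta M mu + j_ mu u + k_ mu u u.

Definition d_cost i u mu : R := partial params (cost u) i mu.

Definition res_pr mu u v : R := l_ mu v - a_ mu u v.
Definition res_du mu u p v : R := j_ mu v + 2 * k_ mu v u - a_ mu v p.
Definition d_res_pr i mu u v : R := dl_ i mu v - da_ i mu u v.
Definition d_res_du i mu u p v : R := dj_ i mu v + 2 * dk_ i mu v u - da_ i mu v p.

Definition primal_solution (W : set V) mu u : Prop :=
  galerkin_solution W (a_ mu) (l_ mu) u.

(* In the equations for p and w the test function is the first argument of a. *)
Definition dual_solution (W : set V) mu u p : Prop :=
  galerkin_solution W (fun p q : V => a_ mu q p) (fun q : V => j_ mu q + 2 * k_ mu q u) p.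

Definition z_solution (W : set V) mu u z : Prop :=
  galerkin_solution W (a_ mu) (fun q : V => - res_pr mu u q) z.

Definition w_solution (W : set V) mu u p z w : Prop :=
  galerkin_solution W (fun w v => a_ mu v w)
    (fun v => res_du mu u p v - 2 * k_ mu z v) w.

Definition reduced_cost (us : 'rV[R]_P -> V) mu : R := cost (us mu) mu.

Definition ncd_reduced_cost (ur pr : 'rV[R]_P -> V) mu : R :=
  cost (ur mu) mu + res_pr mu (ur mu) (pr mu).

Definition inexact_gradient (ur pr : 'rV[R]_P -> V) mu : 'rV[R]_P :=
  \row_i (d_cost i (ur mu) mu + d_res_pr i mu (ur mu) (pr mu)).

Definition adjoint_gradient (ur pr zr wr : 'rV[R]_P -> V) mu : 'rV[R]_P :=
  \row_i (d_cost i (ur mu) mu + d_res_pr i mu (ur mu) (pr mu + wr mu)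
          - d_res_du i mu (ur mu) (pr mu) (zr mu)).

Section Estimators.
Variables (Vh : set V) (ur pr : 'rV[R]_P -> V).

Local Notation gamma_lin := (dual_norm Vh).
Local Notation gamma_bil := (bilin_norm Vh).

Definition alpha mu : R := coercivity_constant Vh (a_ mu).
Definition norm_res_pr mu : R := dual_norm Vh (res_pr mu (ur mu)).
Definition norm_res_du mu : R := dual_norm Vh (res_du mu (ur mu) (pr mu)).

Definition Delta_pr mu : R := (alpha mu)^-1 * norm_res_pr mu.

Definition Delta_du mu : R :=
  (alpha mu)^-1 * (2 * gamma_bil (k_ mu) * Delta_pr mu + norm_res_du mu).

Definition Delta_inexact mu : 'rV[R]_P := \row_i
  (2 * Delta_pr mu * `|ur mu| * gamma_bil (dk_ i mu)
   + Delta_pr mu * (gamma_lin (dj_ i mu) + gamma_bil (da_ i mu) * `|pr mu|)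
   + Delta_du mu * (gamma_lin (dl_ i mu) + gamma_bil (da_ i mu) * `|ur mu|)
   + Delta_pr mu * Delta_du mu * gamma_bil (da_ i mu)
   + Delta_pr mu ^+ 2 * gamma_bil (dk_ i mu)).

Definition Delta_ncd mu : 'rV[R]_P := \row_i
  (2 * Delta_pr mu * `|ur mu| * gamma_bil (dk_ i mu)
   + Delta_pr mu * (gamma_lin (dj_ i mu) + gamma_bil (da_ i mu) * `|pr mu|)
   + Delta_du mu * (gamma_lin (dl_ i mu) + gamma_bil (da_ i mu) * `|ur mu|)
   + Delta_pr mu * Delta_du mu * gamma_bil (da_ i mu)
   + Delta_pr mu ^+ 2 * gamma_bil (dk_ i mu)
   + (gamma_lin (dl_ i mu) + gamma_bil (da_ i mu) * `|ur mu|) * (alpha mu)^-1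
     * (norm_res_du mu + 2 * gamma_bil (k_ mu) * (alpha mu)^-1 * norm_res_pr mu)
   + (alpha mu)^-1 * norm_res_pr mu
     * (gamma_lin (dj_ i mu) + 2 * gamma_bil (dk_ i mu) * `|ur mu|
        + gamma_bil (da_ i mu) * `|pr mu|)).

End Estimators.

End Problem.

(* Main.v *)
(* Along a coordinate direction a Galerkin solution is Lipschitz in
   the parameter: the differenced equation, coercivity and the boundedness of all
   forms on the finite-dimensional space V_h bound its increment by a multiple of
   the step.  Increments of solutions therefore contribute to the difference
   quotient of the corrected functional only through the residuals r_du[du] and
   r_pr[dp], and the equations for z and w trade these for increments of the
   coefficients, which gives the adjoint gradient without differentiating the
   solutions.  The full order functional is the case where both reduced spaces
   are V_h, whose residuals, z and w vanish.  The estimates then follow from the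
   coercivity bounds |u_h - u_r| <= Delta_pr, |p_h - p_r| <= Delta_du,
   |z_r| <= Delta_pr and |w_r| <= Delta_du. *)

Require Import Defs.
From HB Require Import structures.
From mathcomp Require Import all_boot all_order all_algebra.
From mathcomp Require Import sesquilinear.
From mathcomp Require Import boolp classical_sets reals topology normedtype.
From mathcomp Require Import landau derive.
From mathcomp Require Import ring lra.
Import Order.TTheory GRing.Theory Num.Theory.
Import numFieldNormedType.Exports.
Local Open Scope classical_set_scope.
Local Open Scope ring_scope.
Set Implicit Arguments.
Unset Strict Implicit.
Unset Printing Implicit Defensive.

(** * Orthonormal frames, Riesz representation and bounded forms on finite-dimensional subspaces *)

Section FiniteDimensional.
Variables (R : realType) (V : normedModType R).
Implicit Types (W : set V) (phi : {scalar V}) (b : {biscalar V}).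

Lemma biscalarZl b a u v : b (a *: u) v = a * b u v.
Proof. exact: linearZl_LR. Qed.

Lemma biscalarZr b a u v : b u (a *: v) = a * b u v.
Proof. exact: linearZr_LR. Qed.

Lemma biscalarBl b u v w : b (u - v) w = b u w - b v w.
Proof. exact: linearBl. Qed.

Lemma biscalarBr b u v w : b u (v - w) = b u v - b u w.
Proof. exact: linearBr. Qed.

Lemma linear_subspace0 W : linear_subspace W -> W 0.
Proof. by case=> /set_mem. Qed.

Lemma linear_subspaceP W a u v :
  linear_subspace W -> W u -> W v -> W (a *: u + v).
Proof. by case=> _ Wlin Wu Wv; apply/set_mem/Wlin; apply/mem_set. Qed.

Lemma linear_subspaceD W u v : linear_subspace W -> W u -> W v -> W (u + v).
Proof. by move=> Wl Wu Wv; rewrite -[u]scale1r; exact: linear_subspaceP. Qed.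

Lemma linear_subspaceZ W a u : linear_subspace W -> W u -> W (a *: u).
Proof.
move=> Wl Wu; rewrite -[_ *: _]addr0.
by apply: linear_subspaceP => //; exact: linear_subspace0.
Qed.

Lemma linear_subspaceB W u v : linear_subspace W -> W u -> W v -> W (u - v).
Proof. by move=> Wl Wu Wv; rewrite addrC -scaleN1r; exact: linear_subspaceP. Qed.

Lemma linear_subspace_sum W (I : eqType) (s : seq I) (f : I -> V) :
  linear_subspace W -> (forall i, i \in s -> W (f i)) -> W (\sum_(i <- s) f i).
Proof.
move=> Wl; elim: s => [|x s IH] Wf; first by rewrite big_nil; exact: linear_subspace0.
rewrite big_cons; apply: linear_subspaceD => //; first by apply: Wf; rewrite mem_head.
by apply: IH => i si; apply: Wf; rewrite in_cons si orbT.
Qed.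

Lemma linear_subspace_span n (e : 'I_n -> V) :
  linear_subspace [set v | exists c : 'I_n -> R, v = \sum_i c i *: e i].
Proof.
split.
  by apply/mem_set; exists (fun=> 0); rewrite big1 // => i _; rewrite scale0r.
move=> a u v /set_mem[c ->] /set_mem[d ->]; apply/mem_set.
exists (fun i => a * c i + d i); rewrite scaler_sumr -big_split.
by apply: eq_bigr => i _; rewrite scalerA scalerDl.
Qed.

Lemma finite_dim_linear W : finite_dim_subspace W -> linear_subspace W.
Proof. by case=> n [e ->]; exact: linear_subspace_span. Qed.

(* The reproducing property of a b-orthonormal basis, which is all that is
   needed of one. *)
Definition parseval_frame b W (fs : seq V) : Prop :=
  (forall f, f \in fs -> W f) /\
  forall v, W v -> v = \sum_(f <- fs) b v f *: f.

Definition positive_definite (b : V -> V -> R) : Prop :=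
  forall v, v != 0 -> 0 < b v v.

Section Frames.
Variables (b : {biscalar V}) (b_sym : Defs.symmetric_form b).
Hypothesis b_pos : positive_definite b.

(** One Gram-Schmidt step: the part of [e] that is [b]-orthogonal to [W] is normalised and put in
    front of the frame. *)
Lemma parseval_frame_extend W fs e :
  linear_subspace W -> parseval_frame b W fs ->
  exists gs, parseval_frame b [set v | exists2 w, W w & exists t, v = w + t *: e] gs.
Proof.
move=> Wl [fsW fsP].
pose Pe := \sum_(f <- fs) b e f *: f.
have WPe : W Pe.
  by apply: linear_subspace_sum => // f /fsW; exact: linear_subspaceZ.
(* The reproducing property is applied to a frame vector [f] itself: expanding [f] in the frame
   turns [b e f] into [b Pe f]. *)
have orth w : W w -> b (e - Pe) w = 0.
  move=> /fsP ->; rewrite linear_sumr big_seq big1// => f /fsW Wf.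
  rewrite biscalarZr linearBl/= /Pe linear_sumlz.
  apply/eqP; rewrite mulf_eq0; apply/orP; right; rewrite subr_eq0; apply/eqP.
  rewrite [in LHS](fsP f Wf) linear_sumr; apply: eq_bigr => g _.
  by rewrite biscalarZr biscalarZl [b f g]b_sym mulrC.
(* If [e] already lies in [W], the old frame serves; this absorbs linearly dependent spanning
   vectors. *)
have [e0|en0] := eqVneq (e - Pe) 0.
  exists fs; split=> [f /fsW Wf|v [w Ww [t ->]]].
    by exists f => //; exists 0; rewrite scale0r addr0.
  apply: fsP; apply: linear_subspaceD => //; move/eqP: e0; rewrite subr_eq0 => /eqP ->.
  exact: linear_subspaceZ.
have bpos := b_pos en0.
pose s := Num.sqrt (b (e - Pe) (e - Pe)).
have s0 : s != 0 by rewrite sqrtr_eq0 -ltNge.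
have ss : s ^+ 2 = b (e - Pe) (e - Pe) by rewrite sqr_sqrtr// ltW.
pose g := s^-1 *: (e - Pe).
have bgw w : W w -> b g w = 0 by move=> Ww; rewrite biscalarZl orth// mulr0.
have bgg : b g g = 1.
  by rewrite biscalarZl biscalarZr -ss expr2 mulKf// mulVf.
exists (g :: fs); split=> [f|v [w Ww [t ->]]].
  rewrite in_cons => /orP[/eqP ->|/fsW Wf]; last first.
    by exists f => //; exists 0; rewrite scale0r addr0.
  exists (- s^-1 *: Pe); first exact: linear_subspaceZ.
  by exists s^-1; rewrite /g scalerBr scaleNr addrC.
have eE : e = Pe + s *: g by rewrite /g scalerA divff// scale1r addrC subrK.
have -> : w + t *: e = (w + t *: Pe) + (t * s) *: g.
  by rewrite {1}eE scalerDr addrA scalerA.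
have Ww' : W (w + t *: Pe).
  by apply: linear_subspaceD => //; exact: linear_subspaceZ.
move: (w + t *: Pe) Ww' => w' Ww'.
rewrite big_cons linearDl biscalarZl bgg mulr1 [b w' g]b_sym bgw// add0r.
rewrite addrC; congr (_ + _); rewrite {1}(fsP w')//.
apply: eq_big_seq => f /fsW Wf.
by rewrite linearDl biscalarZl bgw// mulr0 add0r.
Qed.

Lemma parseval_frame_exists W :
  finite_dim_subspace W -> exists fs, parseval_frame b W fs.
Proof.
case=> n [e ->]; elim: n e => [|n IH] e.
  exists [::]; split=> // v [c ->]; by rewrite big_ord0 big_nil.
have [fs fsP] := IH (fun i => e (widen_ord (leqnSn n) i)).
have [gs] := parseval_frame_extend (e ord_max) (linear_subspace_span _) fsP.
move=> gsP; exists gs; move: gsP.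
set S := (X in parseval_frame b X gs -> _).
set T := (X in _ -> parseval_frame b X gs).
suff -> : S = T by [].
apply/seteqP; split=> v.
  move=> [_ [c ->] [t ->]]; exists (fun i => if unlift ord_max i is Some j then c j else t).
  rewrite big_ord_recr/= unlift_none; congr (_ + _); apply: eq_bigr => i _.
  rewrite (_ : widen_ord _ i = lift ord_max i) ?liftK//.
  by apply: val_inj; rewrite /= /bump leqNgt ltn_ord.
move=> [c ->]; rewrite big_ord_recr/=; eexists; last by exists (c ord_max).
by exists (fun i => c (widen_ord (leqnSn n) i)).
Qed.

(** The representer is explicit: its frame coefficients are the values [phi f]. With the inner
    product of [V] as [b] it bounds functionals; with the energy form [a_] as [b] it solves the dual
    problem. *)
Lemma riesz_finite_dim W phi : finite_dim_subspace W ->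
  exists2 p, W p & forall v, W v -> b p v = phi v.
Proof.
move=> Wfin; have [fs [fsW fsP]] := parseval_frame_exists Wfin.
exists (\sum_(f <- fs) phi f *: f).
  apply: linear_subspace_sum; first exact: finite_dim_linear.
  by move=> f /fsW; apply: linear_subspaceZ; exact: finite_dim_linear.
move=> v /fsP {2}->; rewrite linear_sumlz linear_sum/=.
apply: eq_bigr => f _; rewrite biscalarZl scalarZ/= b_sym mulrC//.
Qed.

End Frames.

Section Bounded.
Variables (dot : {biscalar V}) (dot_sym : Defs.symmetric_form dot).
Hypothesis norm_dot : forall v, `|v| ^+ 2 = dot v v.

Lemma dot_positive : positive_definite dot.
Proof. by move=> v v0; rewrite -norm_dot exprn_gt0// normr_gt0. Qed.

Lemma cauchy_schwarz u v : `|dot u v| <= `|u| * `|v|.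
Proof.
have [->|v0] := eqVneq v 0; first by rewrite linear0r !normr0 mulr0.
have vv : 0 < dot v v by exact: dot_positive.
(* The vector is [u] minus its projection on [v], cleared of the denominator [dot v v]. *)
have : 0 <= dot (dot v v *: u - dot u v *: v) (dot v v *: u - dot u v *: v).
  by rewrite -norm_dot sqr_ge0.
rewrite linearBl !linearBr/= !biscalarZl !biscalarZr [dot v u]dot_sym => h.
have {h} h : 0 <= dot v v * (dot u u * dot v v - dot u v ^+ 2).
  by apply: le_trans h _; rewrite le_eqVlt; apply/orP; left; apply/eqP; ring.
rewrite -(@ler_pXn2r _ 2)// ?nnegrE ?mulr_ge0//.
rewrite exprMn !norm_dot real_normK ?num_real//.
by move: h; rewrite pmulr_rge0// subr_ge0.
Qed.

Lemma bounded_scalar W phi : finite_dim_subspace W ->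
  exists2 C, 0 <= C & forall v, W v -> `|phi v| <= C * `|v|.
Proof.
move=> Wfin; have [p Wp pP] := riesz_finite_dim dot_sym dot_positive phi Wfin.
by exists `|p| => // v Wv; rewrite -pP//; exact: cauchy_schwarz.
Qed.

(** Expanding the first argument in a frame leaves the finitely many functionals [b f], with
    [dot u f] controlled by Cauchy-Schwarz. The components of the separable forms, and with them the
    differentiated forms, get their bounds on [Vh] from here. *)
Lemma bounded_biscalar W b : finite_dim_subspace W ->
  exists2 C, 0 <= C & forall u v, W u -> W v -> `|b u v| <= C * (`|u| * `|v|).
Proof.
move=> Wfin.
have [fs [_ fsP]] := parseval_frame_exists dot_sym dot_positive Wfin.
have bnd f : exists C, 0 <= C /\ forall v, W v -> `|b f v| <= C * `|v|.
  have [C C0 CP] := bounded_scalar (b f) Wfin.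
  by exists C.
have [C CP] := choice bnd.
exists (\sum_(f <- fs) `|f| * C f).
  by apply: sumr_ge0 => f _; rewrite mulr_ge0//; case: (CP f).
move=> u v Wu Wv; rewrite [in X in X <= _](fsP u Wu) linear_sumlz.
apply: (le_trans (ler_norm_sum _ _ _)); rewrite mulr_suml; apply: ler_sum => f _.
rewrite biscalarZl normrM.
apply: (@le_trans _ _ ((`|u| * `|f|) * (C f * `|v|))).
  by apply: ler_pM => //; [exact: cauchy_schwarz|case: (CP f) => _; exact].
by rewrite le_eqVlt; apply/orP; left; apply/eqP; ring.
Qed.

End Bounded.
End FiniteDimensional.

(** * Dual norms, continuity constants and the coercivity constant *)

Section Constants.
Variables (R : realType) (V : normedModType R) (dot : {biscalar V}).
Hypotheses (dot_sym : Defs.symmetric_form dot)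
  (norm_dot : forall v, `|v| ^+ 2 = dot v v).
Variables (W : set V) (W_fin : finite_dim_subspace W).
Implicit Types (phi : {scalar V}) (b : {biscalar V}).

(** An empty or unbounded set has [sup] equal to 0 by convention, so the degenerate cases are
    covered too. *)
Lemma sup_ge0 (A : set R) : (forall x, A x -> 0 <= x) -> 0 <= sup A.
Proof.
move=> A0; have [[[x Ax] Aub]|/sup_out ->//] := pselect (has_sup A).
by apply: le_trans (A0 _ Ax) _; exact: ub_le_sup.
Qed.

Lemma dual_norm_ge0 (f : V -> R) : 0 <= dual_norm W f.
Proof. by apply: sup_ge0 => _ [v _ <-]; rewrite divr_ge0. Qed.

Lemma bilin_norm_ge0 (f : V -> V -> R) : 0 <= bilin_norm W f.
Proof. by apply: sup_ge0 => _ [v _ <-]; rewrite divr_ge0// mulr_ge0. Qed.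

Lemma dual_norm_le phi v : W v -> `|phi v| <= dual_norm W phi * `|v|.
Proof.
move=> Wv; have [->|v0] := eqVneq v 0; first by rewrite linear0 !normr0 mulr0.
(* The quotients must be bounded above: otherwise the supremum would default to 0 and bound
   nothing. *)
have [C C0 CP] := bounded_scalar dot_sym norm_dot phi W_fin.
rewrite -ler_pdivrMr ?normr_gt0//; apply: ub_le_sup; last by exists v.
by exists C => _ [w [Ww w0] <-]; rewrite ler_pdivrMr ?normr_gt0// CP.
Qed.

Lemma bilin_norm_le b u v : W u -> W v ->
  `|b u v| <= bilin_norm W b * (`|u| * `|v|).
Proof.
move=> Wu Wv; have [->|u0] := eqVneq u 0.
  by rewrite linear0l !normr0 mul0r mulr0.
have [->|v0] := eqVneq v 0; first by rewrite linear0r !normr0 !mulr0.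
have [C C0 CP] := bounded_biscalar dot_sym norm_dot b W_fin.
rewrite -ler_pdivrMr ?mulr_gt0 ?normr_gt0//; apply: ub_le_sup; last first.
  by exists (u, v).
exists C => _ [[w w'] /= [[Ww w0] [Ww' w'0]] <-].
by rewrite ler_pdivrMr ?mulr_gt0 ?normr_gt0// CP.
Qed.

Section Coercivity.
Variables (a : {biscalar V}) (a_coer : coercive a).
Let lb : has_lbound [set a v v / `|v| ^+ 2 | v in [set v | W v /\ v != 0]].
Proof.
case: a_coer => c c0 cP; exists c => _ [v [_ v0] <-].
by rewrite ler_pdivlMr ?exprn_gt0 ?normr_gt0.
Qed.

Lemma coercivity_constant_le v : W v -> coercivity_constant W a * `|v| ^+ 2 <= a v v.
Proof.
move=> Wv; have [->|v0] := eqVneq v 0.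
  by rewrite linear0l normr0 expr0n mulr0.
rewrite -ler_pdivlMr ?exprn_gt0 ?normr_gt0//.
by apply: ge_inf => //; exists v.
Qed.

(** The nonzero vector makes the set of quotients nonempty; on the zero space the infimum defaults
    to 0 and positivity fails. *)
Lemma coercivity_constant_gt0 v : W v -> v != 0 -> 0 < coercivity_constant W a.
Proof.
move=> Wv v0; case: a_coer => c c0 cP; apply: (lt_le_trans c0).
apply: lb_le_inf; first by exists (a v v / `|v| ^+ 2), v.
by move=> _ [w [_ w0] <-]; rewrite ler_pdivlMr ?exprn_gt0 ?normr_gt0.
Qed.

Lemma coercivity_constant_ge0 : 0 <= coercivity_constant W a.
Proof.
have [[v [Wv v0]]|W0] := pselect (exists v, W v /\ v != 0).
  by apply: ltW; exact: coercivity_constant_gt0 Wv v0.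
rewrite /coercivity_constant (_ : [set _ | _ in _] = set0) ?inf0//.
by apply/seteqP; split=> // x [v Wv _]; apply: W0; exists v.
Qed.

(** The common end of all four error bounds: an equation tested with its own error or solution, one
    factor of the norm cancelled. At [v = 0] the constant may be 0, and then the sign of its inverse
    is enough. *)
Lemma coercive_bound v r : W v -> 0 <= r -> a v v <= r * `|v| ->
  `|v| <= (coercivity_constant W a)^-1 * r.
Proof.
move=> Wv r0 avr; have [->|v0] := eqVneq v 0.
  by rewrite normr0 mulr_ge0// invr_ge0 coercivity_constant_ge0.
have al0 := coercivity_constant_gt0 Wv v0.
have nv : 0 < `|v| by rewrite normr_gt0.
rewrite mulrC ler_pdivlMr// -(ler_pM2r nv) mulrAC -expr2 mulrC.
exact: le_trans (coercivity_constant_le Wv) avr.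
Qed.

End Coercivity.
End Constants.

Lemma cvg_sumr (R : realType) (T I : Type) (F : set_system T) {FF : Filter F}
    (s : seq I) (f : I -> T -> R) (l : I -> R) :
  (forall i, f i x @[x --> F] --> l i) ->
  \sum_(i <- s) f i x @[x --> F] --> \sum_(i <- s) l i.
Proof.
move=> fl; elim: s => [|i s IH].
  rewrite big_nil; under eq_fun do rewrite big_nil; exact: cvg_cst.
rewrite big_cons; under eq_fun do rewrite big_cons; exact: cvgD.
Qed.

(** * Difference quotients along the increments that stay in the parameter set *)

Section PartialDerivatives.
Variables (R : realType) (P : nat).
Implicit Types (D : set 'rV[R]_P) (f : 'rV[R]_P -> R) (mu : 'rV[R]_P) (i : 'I_P).

Definition increments D i mu : set_system R :=
  within [set h | D (mu + h *: delta_mx 0 i)] (0 : R)^'.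

Lemma increments_filter D i mu : Filter (increments D i mu).
Proof. exact: within_filter. Qed.

Lemma increments_cvg0 D i mu : h @[h --> increments D i mu] --> (0 : R).
Proof.
apply: cvg_within_filter; exact: nbhs_dnbhs.
Qed.

Lemma increments_neq0 D i mu : \forall h \near increments D i mu, h != 0.
Proof. by rewrite near_withinE; near=> h => _; near: h; exact: nbhs_dnbhs_neq. 
Unshelve. all: by end_near. Qed.

(** By convexity of the box, one admissible increment [h] makes every [t * h] with [0 < t <= 1]
    admissible, so admissible increments accumulate at 0. *)
Lemma box_increments_proper mua mub i mu (h : R) :
  box mua mub mu -> h != 0 -> box mua mub (mu + h *: delta_mx 0 i) ->
  ProperFilter (increments (box mua mub) i mu).
Proof.
move=> Dmu h0 Dh; have FF := increments_filter (box mua mub) i mu.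
apply: Build_ProperFilter_ex => A.
rewrite /increments /within /= => /nbhs_ballP [e /= e0 eA].
(* The bound 1 keeps the point on the segment; the other bound puts [t * h] in the ball of radius
   [e]. *)
pose t := Num.min 1 (e / 2 / `|h|).
have nh : 0 < `|h| by rewrite normr_gt0.
have t0 : 0 < t by rewrite lt_min ltr01 !divr_gt0.
have t1 : t <= 1 by rewrite ge_min lexx.
exists (t * h); apply: eA.
- rewrite -ball_normE /= sub0r normrN normrM gtr0_norm//.
  apply: (@le_lt_trans _ _ (e / 2)); last by rewrite ltr_pdivrMr// ltr_pMr// ltr1n.
  by rewrite -ler_pdivlMr// ge_min lexx orbT.
- by rewrite mulf_neq0// gt_eqF.
- move=> j; have := Dmu j; have := Dh j; rewrite !mxE /= => /andP[h1 h2] /andP[m1 m2].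
  move: h1 h2; set d := (_ == _)%:R => h1 h2.
  have -> : mu 0 j + t * h * d = (1 - t) * mu 0 j + t * (mu 0 j + h * d) by ring.
  by apply/andP; split; nra.
Qed.

Lemma increments_cvg D i mu :
  (mu + h *: delta_mx 0 i) @[h --> increments D i mu] --> within D (nbhs mu).
Proof.
have FF := increments_filter D i mu.
have c : (mu + h *: delta_mx 0 i) @[h --> increments D i mu] --> mu.
  rewrite -[X in _ --> X]addr0; apply: cvgD; first exact: cvg_cst.
  rewrite -(scale0r (delta_mx 0 i : 'rV[R]_P)); apply: cvgZr_tmp.
  exact: increments_cvg0.
move=> A /= /c; rewrite /fmap /= => h.
have Dh : \forall h \near increments D i mu, D (mu + h *: delta_mx 0 i).
  exact: near_withinT.
by apply: filterS2 Dh h => h /= Dh; exact.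
Qed.

Lemma partial_val D f i mu l : ProperFilter (increments D i mu) ->
  (exists2 h : R, h != 0 & D (mu + h *: delta_mx 0 i)) ->
  (h^-1 * (f (mu + h *: delta_mx 0 i) - f mu)) @[h --> increments D i mu] --> l ->
  partial D f i mu = l.
Proof.
move=> FF ex fl; rewrite /partial; case: asboolP => // _.
exact: (cvg_lim (@Rhausdorff R) fl).
Qed.

(** The relative Frechet differential in the coordinate direction is a limit of the quotients, and
    uniqueness of limits identifies it with [partial]. *)
Lemma cvg_partial D f i mu : ProperFilter (increments D i mu) ->
  (exists2 h : R, h != 0 & D (mu + h *: delta_mx 0 i)) -> D mu ->
  differentiable_on (W := R^o) D f ->
  (h^-1 * (f (mu + h *: delta_mx 0 i) - f mu)) @[h --> increments D i mu]
    --> partial D f i mu.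
Proof.
move=> FF ex Dmu fD.
have [d dP] : exists d : {linear 'rV[R]_P -> R^o}, forall e : R, 0 < e ->
    \forall x \near within D (nbhs mu), `|f x - f mu - d (x - mu)| <= e * `|x - mu|.
  have [[_ /eqaddoP fo]] := fD _ Dmu.
  (* Differentiability along a filter is centred at the [lim] of that filter; properness, which
     holds since [mu] is in [D], makes this limit [mu]. *)
  have wF : ProperFilter (within D (nbhs mu)).
    apply: Build_ProperFilter_ex => A /nbhs_singleton /(_ Dmu) Amu.
    by exists mu.
  have lE : lim (nbhs (within D (nbhs mu))) = mu.
    apply: (@cvg_lim _ _ _ (within D (nbhs mu)) _ id mu) => //.
    exact: cvg_within.
  rewrite lE in fo; exists ('d (f : _ -> R^o) (within D (nbhs mu))) => e e0.
  apply: filterS (fo e e0) => x /= h.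
  by rewrite -addrA -opprD; exact: h.
have FF' := increments_filter D i mu.
suff c : (h^-1 * (f (mu + h *: delta_mx 0 i) - f mu)) @[h --> increments D i mu]
   --> (d (delta_mx 0 i) : R) by rewrite (partial_val FF ex c).
pose N := `|delta_mx 0 i : 'rV[R]_P|.
apply/cvgrPdist_le => e e0.
have N1 : 0 < N + 1 by apply: ltr_wpDl => //; exact: normr_ge0.
have near1 : \forall h \near increments D i mu,
    `|f (mu + h *: delta_mx 0 i) - f mu - d (mu + h *: delta_mx 0 i - mu)|
      <= e / (N + 1) * `|mu + h *: delta_mx 0 i - mu|.
  exact: (increments_cvg i (dP _ (divr_gt0 e0 N1))).
apply: filterS2 near1 (increments_neq0 D i mu) => h /= hP h0.
have nh : 0 < `|h| by rewrite normr_gt0.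
move: hP; rewrite [mu + _]addrC addrK linearZ/= -[_ *: d _]/(h * d _) normrZ -/N => hP.
rewrite distrC -(ler_pM2l nh) -normrM mulrBr mulVKf//.
apply: (le_trans hP); rewrite mulrCA [X in _ <= X]mulrC [X in _ <= X]mulrC ler_pM2l//.
rewrite mulrAC ler_pdivrMr// ler_pM2l// lerDl//.
Qed.
End PartialDerivatives.

(** * Difference quotients uniform in the arguments of a form *)

Section UniformDerivative.
Variables (R : realType) (F : set_system R).
Context {FF : Filter F}.
Hypotheses (F0 : h @[h --> F] --> (0 : R)) (F_neq0 : \forall h \near F, h != 0).

(* Difference quotients converging uniformly with respect to the weight N: for
   forms, N is the product of the norms of the arguments. *)
Definition uderiv (T : Type) (S : set T) (N : T -> R)
    (g : R -> T -> R) (g0 dg : T -> R) : Prop :=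
  forall e, 0 < e -> \forall h \near F, forall t, S t ->
    `|h^-1 * (g h t - g0 t) - dg t| <= e * N t.

(** Lipschitz against the base value only; this takes the place of differentiability of the solution
    maps. *)
Definition near_lipschitz (U : normedModType R) (x : R -> U) (x0 : U) : Prop :=
  exists2 C, 0 <= C & \forall h \near F, `|x h - x0| <= C * `|h|.

Lemma near_small (e : R) : 0 < e -> \forall h \near F, `|h| <= e.
Proof.
move=> e0; have /cvgr0Pnorm_le := F0; exact.
Qed.

Lemma near_lipschitz_cvg (g : R -> R) l :
  near_lipschitz (g : R -> R^o) l -> g h @[h --> F] --> l.
Proof.
move=> [C C0 gC]; apply/cvgrPdist_le => e e0.
have C1 : 0 < C + 1 by rewrite ltr_wpDl.
apply: filterS2 gC (near_small (divr_gt0 e0 C1)) => h gh he.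
rewrite distrC; apply: (le_trans gh).
apply: (@le_trans _ _ ((C + 1) * `|h|)); first by rewrite ler_wpM2r// lerDl.
by rewrite mulrC -ler_pdivlMr.
Qed.

Lemma eq_near_cvg (f g : R -> R) (l : R) : (\forall h \near F, f h = g h) ->
  f h @[h --> F] --> l -> g h @[h --> F] --> l.
Proof.
by move=> fg fl A /fl; rewrite /fmap /= => fA; apply: filterS2 fg fA => h /= <-.
Qed.

Section Family.
Variables (T : Type) (S : set T) (N : T -> R).
Hypothesis N0 : forall t, 0 <= N t.

(** Only the coefficients vary with the step, so the error is at most the weight times a finite sum
    of scalar errors, each multiplied by the bound of its component. *)
Lemma uderiv_separable n (theta : 'I_n -> R -> R) (theta0 dtheta : 'I_n -> R)
    (c : 'I_n -> T -> R) :
  (forall q, h^-1 * (theta q h - theta0 q) @[h --> F] --> dtheta q) ->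
  (forall q, exists2 C, 0 <= C & forall t, S t -> `|c q t| <= C * N t) ->
  uderiv S N (fun h t => \sum_q theta q h * c q t)
    (fun t => \sum_q theta0 q * c q t) (fun t => \sum_q dtheta q * c q t).
Proof.
move=> thetaP cP e e0.
have cP' q : exists C, 0 <= C /\ forall t, S t -> `|c q t| <= C * N t.
  by have [C] := cP q; exists C.
have [C CP] := choice cP'.
have : \sum_q `|h^-1 * (theta q h - theta0 q) - dtheta q| * C q @[h --> F]
    --> \sum_(q < n) `|dtheta q - dtheta q| * C q.
  apply: cvg_sumr => q; apply: cvgMr_tmp; apply: cvg_norm; apply: cvgB => //.
  exact: cvg_cst.
rewrite big1 => [|q _]; last by rewrite subrr normr0 mul0r.
move=> /cvgr0Pnorm_le /(_ e e0); apply: filterS => h he t St.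
rewrite -sumrB mulr_sumr -sumrB; apply: (le_trans (ler_norm_sum _ _ _)).
apply: (@le_trans _ _
  (\sum_q `|h^-1 * (theta q h - theta0 q) - dtheta q| * C q * N t)).
  apply: ler_sum => q _; have [_ cq] := CP q.
  rewrite (_ : _ - _ = (h^-1 * (theta q h - theta0 q) - dtheta q) * c q t); last by ring.
  by rewrite normrM -mulrA ler_wpM2l// cq.
by rewrite -mulr_suml ler_wpM2r// (le_trans _ he)// ler_norm.
Qed.

Variables (g : R -> T -> R) (g0 dg : T -> R) (Cd : R).
Hypotheses (g_deriv : uderiv S N g g0 dg) (Cd0 : 0 <= Cd)
  (dg_bnd : forall t, S t -> `|dg t| <= Cd * N t).

Lemma uderiv_lipschitz : exists2 C, 0 <= C &
  \forall h \near F, forall t, S t -> `|g h t - g0 t| <= C * `|h| * N t.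
Proof.
(* The summand 1 is the tolerance chosen in the uniform derivative. *)
exists (Cd + 1); first by rewrite addr_ge0.
apply: filterS2 (g_deriv ltr01) F_neq0 => h gh h0 t St.
have nh : 0 < `|h| by rewrite normr_gt0.
rewrite -(mulVKf h0 (g h t - g0 t)) normrM [_ * `|h|]mulrC -mulrA ler_pM2l//.
rewrite -(subrK (dg t) (h^-1 * _)) (le_trans (ler_normD _ _))//.
by rewrite addrC mulrDl lerD// ?dg_bnd// gh.
Qed.

(** Uniformity lets the arguments move with the step, as long as their weight stays bounded. *)
Lemma uderiv_cvg (t : R -> T) (t0 : T) (M : R) :
  (\forall h \near F, S (t h)) -> (\forall h \near F, N (t h) <= M) ->
  dg (t h) @[h --> F] --> dg t0 ->
  h^-1 * (g h (t h) - g0 (t h)) @[h --> F] --> dg t0.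
Proof.
move=> St tM dgt.
have c0 : h^-1 * (g h (t h) - g0 (t h)) - dg (t h) @[h --> F] --> (0 : R).
  apply/cvgr0Pnorm_le => e e0.
  have M1 : 0 < `|M| + 1 by rewrite ltr_wpDl.
  apply: filterS3 (g_deriv (divr_gt0 e0 M1)) St tM => h gh Sh Mh.
  apply: (le_trans (gh _ Sh)); rewrite mulrAC ler_pdivrMr// ler_wpM2l//; first exact: ltW.
  by rewrite (le_trans Mh)// (le_trans (ler_norm _))// lerDl.
rewrite -[dg t0]add0r.
apply: eq_near_cvg (cvgD c0 dgt).
by apply: filterE => h; rewrite /= subrK.
Qed.

End Family.

(** * Forms evaluated along Lipschitz curves of solutions *)

Section Forms.
Variables (V : normedModType R) (W : set V).
Hypotheses (W_lin : linear_subspace W).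
Implicit Types (b a : {biscalar V}) (phi : {scalar V}).

Definition bounded_form (b : V -> V -> R) : Prop :=
  exists2 C, 0 <= C & forall u v, W u -> W v -> `|b u v| <= C * (`|u| * `|v|).

Definition bounded_functional (phi : V -> R) : Prop :=
  exists2 C, 0 <= C & forall v, W v -> `|phi v| <= C * `|v|.

Definition lin_deriv (g : R -> V -> R) g0 dg := uderiv W (fun v => `|v|) g g0 dg.

Definition bil_deriv (g : R -> V -> V -> R) (g0 dg : V -> V -> R) :=
  uderiv [set t : V * V | W t.1 /\ W t.2] (fun t => `|t.1| * `|t.2|)
    (fun h t => g h t.1 t.2) (fun t => g0 t.1 t.2) (fun t => dg t.1 t.2).

Definition curve (x : R -> V) (x0 : V) : Prop :=
  [/\ W x0, \forall h \near F, W (x h) & near_lipschitz x x0].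

Lemma curve_cst x0 : W x0 -> curve (fun=> x0) x0.
Proof.
move=> Wx; split=> //; first by near=> h.
by exists 0 => //; near=> h; rewrite subrr normr0 mul0r.
Unshelve. all: by end_near. Qed.

Lemma curve_bounded x x0 : curve x x0 -> \forall h \near F, `|x h| <= `|x0| + 1.
Proof.
move=> [_ _ [C C0 xC]]; have C1 : 0 < C + 1 by rewrite ltr_wpDl.
apply: filterS2 xC (near_small (divr_gt0 ltr01 C1)) => h xh.
rewrite ler_pdivlMr// => hC.
rewrite -{1}(subrK x0 (x h)) addrC (le_trans (ler_normD _ _))// lerD2l.
by apply: (le_trans xh); nra.
Qed.

Lemma bil_curve_cvg b x x0 y y0 : bounded_form b -> curve x x0 -> curve y y0 ->
  b (x h) (y h) @[h --> F] --> b x0 y0.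
Proof.
move=> [C C0 bC] cx cy; have yB := curve_bounded cy.
case: cx cy => Wx Wxh [Cx Cx0 xC] [Wy Wyh [Cy Cy0 yC]].
apply: near_lipschitz_cvg; exists (C * (Cx * (`|y0| + 1) + `|x0| * Cy)).
  by rewrite mulr_ge0// addr_ge0// mulr_ge0// addr_ge0.
near=> h; have Wh : W (x h) by near: h.
have Wh' : W (y h) by near: h.
have -> : b (x h) (y h) - b x0 y0 = b (x h - x0) (y h) + b x0 (y h - y0).
  by rewrite linearBl linearBr/=; ring.
have h1 : `|x h - x0| <= Cx * `|h| by near: h.
have h2 : `|y h - y0| <= Cy * `|h| by near: h.
have h3 : `|y h| <= `|y0| + 1 by near: h.
rewrite -mulrA (le_trans (ler_normD _ _))// mulrDl mulrDr lerD//.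
  apply: (le_trans (bC _ _ (linear_subspaceB W_lin Wh Wx) Wh')).
  by rewrite ler_wpM2l// mulrAC ler_pM.
apply: (le_trans (bC _ _ Wx (linear_subspaceB W_lin Wh' Wy))).
by rewrite ler_wpM2l// -mulrA ler_wpM2l.
Unshelve. all: by end_near. Qed.

Lemma lin_curve_cvg phi x x0 : bounded_functional phi -> curve x x0 ->
  phi (x h) @[h --> F] --> phi x0.
Proof.
move=> [C C0 pC] [Wx Wxh [Cx Cx0 xC]].
apply: near_lipschitz_cvg; exists (C * Cx); first exact: mulr_ge0.
apply: filterS2 Wxh xC => h Wh xh.
rewrite -linearB (le_trans (pC _ (linear_subspaceB W_lin Wh Wx)))//.
by rewrite -mulrA ler_wpM2l.
Qed.

(** Both increments are of order [h], so their product survives division by [h] as a term of order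
    [h]. *)
Lemma bil_curve_quadratic b x x0 y y0 : bounded_form b -> curve x x0 -> curve y y0 ->
  h^-1 * b (x h - x0) (y h - y0) @[h --> F] --> (0 : R).
Proof.
move=> [C C0 bC] [Wx Wxh [Cx Cx0 xC]] [Wy Wyh [Cy Cy0 yC]].
apply: near_lipschitz_cvg; exists (C * (Cx * Cy)); first by rewrite !mulr_ge0.
near=> h; have Wh : W (x h) by near: h.
have Wh' : W (y h) by near: h.
have h1 : `|x h - x0| <= Cx * `|h| by near: h.
have h2 : `|y h - y0| <= Cy * `|h| by near: h.
have nh : 0 < `|h| by rewrite normr_gt0; near: h.
rewrite subr0 normrM normfV mulrC ler_pdivrMr//.
apply: (le_trans (bC _ _ (linear_subspaceB W_lin Wh Wx) (linear_subspaceB W_lin Wh' Wy))).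
rewrite -!mulrA ler_wpM2l//.
rewrite (_ : Cx * _ = Cx * `|h| * (Cy * `|h|)); last by ring.
exact: ler_pM.
Unshelve. all: by end_near. Qed.

Lemma lin_deriv_cvg g g0 (dg : {scalar V}) x x0 : lin_deriv g g0 dg ->
  bounded_functional dg -> curve x x0 ->
  h^-1 * (g h (x h) - g0 (x h)) @[h --> F] --> dg x0.
Proof.
move=> gd dgB cx; have xB := curve_bounded cx; case: (cx) => _ Wxh _.
apply: (uderiv_cvg (t := x) (t0 := x0) (M := `|x0| + 1) gd) => //.
exact: lin_curve_cvg.
Qed.

Lemma bil_deriv_cvg g g0 (dg : {biscalar V}) x x0 y y0 : bil_deriv g g0 dg ->
  bounded_form dg -> curve x x0 -> curve y y0 ->
  h^-1 * (g h (x h) (y h) - g0 (x h) (y h)) @[h --> F] --> dg x0 y0.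
Proof.
move=> gd dgB cx cy; have xB := curve_bounded cx; have yB := curve_bounded cy.
case: (cx) (cy) => _ Wxh _ [_ Wyh _].
apply: (uderiv_cvg (t := fun h => (x h, y h)) (t0 := (x0, y0))
  (M := (`|x0| + 1) * (`|y0| + 1)) gd) => //=.
- by apply: filterS2 Wxh Wyh.
- by apply: filterS2 xB yB => h hx hy; exact: ler_pM.
- exact: bil_curve_cvg.
Qed.

(** The two Galerkin equations are subtracted and tested with the increment [d]. The change of the
    form acts on [x h], of norm at most that of [x0] plus that of [d], and coercivity absorbs the
    latter part. The unknown is the second argument, as in the dual equation; the primal equation
    fits by symmetry. *)
Lemma galerkin_curve (S : set V) (ah : R -> V -> V -> R) a (fh : R -> V -> R)
    (f0 : V -> R) (x : R -> V) x0 c Ca Cf :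
  linear_subspace S -> S `<=` W -> 0 < c ->
  (forall v, c * `|v| ^+ 2 <= a v v) ->
  0 <= Ca -> (\forall h \near F, forall u v, W u -> W v ->
    `|ah h u v - a u v| <= Ca * `|h| * (`|u| * `|v|)) ->
  0 <= Cf -> (\forall h \near F, forall v, W v ->
    `|fh h v - f0 v| <= Cf * `|h| * `|v|) ->
  S x0 -> (forall q, S q -> a q x0 = f0 q) ->
  (\forall h \near F, S (x h) /\ forall q, S q -> ah h q (x h) = fh h q) ->
  curve x x0.
Proof.
move=> S_lin SW c0 ac Ca0 aC Cf0 fC Sx0 x0P xP; split; first exact: SW.
  by apply: filterS xP => h [/SW].
(* Half of the coercivity is spent on absorption; the remaining [c / 2] gives the factor [2 / c]. *)
exists (2 / c * (Cf + Ca * `|x0|)).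
  by rewrite mulr_ge0 ?divr_ge0 ?addr_ge0 ?mulr_ge0// ltW.
have Ca1 : 0 < Ca + 1 by rewrite ltr_wpDl.
have c2 : 0 < c / 2 by rewrite divr_gt0.
near=> h.
(* For such steps the change of the form is at most [c / 2] in norm, which makes the absorption
   possible. *)
have hs : `|h| <= c / 2 / (Ca + 1) by near: h; apply: near_small; exact: divr_gt0.
have [Sxh xhP] : S (x h) /\ forall q, S q -> ah h q (x h) = fh h q by near: h.
have ha : forall u v, W u -> W v -> `|ah h u v - a u v| <= Ca * `|h| * (`|u| * `|v|).
  by near: h.
have hf : forall v, W v -> `|fh h v - f0 v| <= Cf * `|h| * `|v| by near: h.
have Sd : S (x h - x0) by exact: linear_subspaceB.
pose d := x h - x0; have [d0|d0] := eqVneq d 0.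
  by rewrite -/d d0 normr0 !mulr_ge0 ?addr_ge0 ?mulr_ge0 ?invr_ge0// ltW.
have nd : 0 < `|d| by rewrite normr_gt0.
have e1 : a d d = (fh h d - f0 d) - (ah h d (x h) - a d (x h)).
  by rewrite xhP// -x0P// {2}/d linearBr/=; ring.
have e2 : a d d <= Cf * `|h| * `|d| + Ca * `|h| * (`|d| * (`|x0| + `|d|)).
  rewrite e1 (le_trans (ler_norm _))// (le_trans (ler_normB _ _))// lerD//.
    by apply: hf; exact: SW.
  apply: (le_trans (ha _ _ (SW _ Sd) (SW _ Sxh))).
  rewrite ler_wpM2l ?mulr_ge0// ler_wpM2l//.
  by rewrite -{1}(subrK x0 (x h)) addrC; exact: ler_normD.
have e3 : c * `|d| <= Cf * `|h| + Ca * `|h| * (`|x0| + `|d|).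
  rewrite -(ler_pM2r nd); have := le_trans (ac d) e2; rewrite expr2.
  by rewrite mulrA => /le_trans; apply; rewrite le_eqVlt; apply/orP; left; apply/eqP; ring.
have e4 : Ca * `|h| <= c / 2.
  move: hs; rewrite ler_pdivlMr// => hs; apply: le_trans hs.
  by rewrite mulrC ler_wpM2l// lerDl.
rewrite -/d (_ : 2 / c * _ * _ = 2 * (Cf + Ca * `|x0|) * `|h| / c); last by ring.
by rewrite ler_pdivlMr//; nra.
Unshelve. all: by end_near. Qed.

Section Functional.
Variables (Theta : R -> R) (Theta0 dTheta : R).
Variables (ah kh : R -> V -> V -> R) (a k da dk : {biscalar V}).
Variables (lh jh : R -> V -> R) (l j dl dj : {scalar V}).
Hypotheses (a_bnd : bounded_form a) (k_bnd : bounded_form k)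
  (da_bnd : bounded_form da) (dk_bnd : bounded_form dk)
  (dl_bnd : bounded_functional dl) (dj_bnd : bounded_functional dj).
Hypotheses (Theta_deriv : h^-1 * (Theta h - Theta0) @[h --> F] --> dTheta)
  (a_deriv : bil_deriv ah a da) (k_deriv : bil_deriv kh k dk)
  (l_deriv : lin_deriv lh l dl) (j_deriv : lin_deriv jh j dj).
Hypothesis k_sym : Defs.symmetric_form k.

(* Up to the quadratic terms k(du, du) - a(du, dp), the increments du and dp of
   the reduced solutions enter only through r_du[du] and r_pr[dp].  The
   equations for w and z turn these into a(du, w) + 2 k(z, du) - a(z, dp), which
   the differenced primal and dual equations express by increments of the
   coefficients: no derivative of the solutions is needed. *)
Lemma ncd_derivative (Vpr Vdu : set V) (u p : R -> V) u0 p0 z w :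
  linear_subspace Vpr -> linear_subspace Vdu -> Vpr `<=` W -> Vdu `<=` W ->
  curve u u0 -> curve p p0 ->
  Vpr u0 -> (forall v, Vpr v -> a u0 v = l v) ->
  (\forall h \near F, Vpr (u h) /\ forall v, Vpr v -> ah h (u h) v = lh h v) ->
  Vdu p0 -> (forall q, Vdu q -> a q p0 = j q + 2 * k q u0) ->
  (\forall h \near F, Vdu (p h) /\
     forall q, Vdu q -> ah h q (p h) = jh h q + 2 * kh h q (u h)) ->
  Vdu z -> (forall q, Vdu q -> a z q = - (l q - a u0 q)) ->
  Vpr w -> (forall v, Vpr v -> a v w = j v + 2 * k v u0 - a v p0 - 2 * k z v) ->
  h^-1 * (Theta h + jh h (u h) + kh h (u h) (u h)
            + (lh h (p h) - ah h (u h) (p h))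
          - (Theta0 + j u0 + k u0 u0 + (l p0 - a u0 p0))) @[h --> F] -->
  dTheta + dj u0 + dk u0 u0 + (dl (p0 + w) - da u0 (p0 + w))
    - (dj z + 2 * dk z u0 - da z p0).
Proof.
move=> Vpr_lin Vdu_lin prW duW cu cp Vu0 u0P uP Vp0 p0P pP Vz zP Vw wP.
have cz := curve_cst (duW _ Vz); have cw := curve_cst (prW _ Vw).
have c1 := lin_deriv_cvg j_deriv dj_bnd cu.
have c2 := bil_deriv_cvg k_deriv dk_bnd cu cu.
have c3 := lin_deriv_cvg l_deriv dl_bnd cp.
have c4 := bil_deriv_cvg a_deriv da_bnd cu cp.
have c5 := lin_deriv_cvg l_deriv dl_bnd cw.
have c6 := bil_deriv_cvg a_deriv da_bnd cu cw.
have c7 := lin_deriv_cvg j_deriv dj_bnd cz.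
have c8 := bil_deriv_cvg k_deriv dk_bnd cz cu.
have c9 := bil_deriv_cvg a_deriv da_bnd cz cp.
have q1 := bil_curve_quadratic k_bnd cu cu.
have q2 := bil_curve_quadratic a_bnd cu cp.
(* The two zeros stand for the limits of the quadratic terms [k(du, du)] and [a(du, dp)]. *)
rewrite (_ : dTheta + _ + _ + _ - _ = dTheta + dj u0 + dk u0 u0 + dl p0 - da u0 p0
   + dl w - da u0 w - dj z - 2 * dk z u0 + da z p0 + 0 - 0); last first.
  by rewrite linearD linearDr/=; ring.
apply: eq_near_cvg (cvgB (cvgD (cvgD (cvgB (cvgB (cvgB (cvgD (cvgB (cvgD (cvgD (cvgD
  Theta_deriv c1) c2) c3) c4) c5) c6) c7) (cvgMl_tmp (a := 2) c8)) c9) q1) q2).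
(* The step is now fixed: the difference quotient equals the sum of the quotients above by algebra
   alone. *)
apply: filterS2 uP pP => h [Vuh uhP] [Vph phP].
have Vdu' : Vpr (u h - u0) by exact: linear_subspaceB.
have Vdp : Vdu (p h - p0) by exact: linear_subspaceB.
have := wP _ Vdu'; have := zP _ Vdp.
rewrite !functions.fctE /= !(biscalarBl a) !(biscalarBl k) !(biscalarBr a)
  !(biscalarBr k) (linearB l) (linearB j) => /eqP.
rewrite subr_eq => /eqP zph /eqP; rewrite subr_eq => /eqP uhw.
(* At both parameters the primal equation is tested with [w] and the dual one with [z]. *)
rewrite (uhP _ Vw) (phP _ Vz) zph uhw (p0P _ Vz) (u0P _ Vw) (k_sym u0 (u h)).
ring.
Qed.


End Functional.
End Forms.
End UniformDerivative.

(** * Linear and bilinear structure of separable forms, their derivatives and the residuals *)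

Section SeparableForms.
Variables (R : realType) (V : normedModType R) (P : nat).
Implicit Types (mu : 'rV[R]_P).

Lemma scalar_comb (n : nat) (c : 'I_n -> R) (f : 'I_n -> V -> R) :
  (forall q, GRing.linear_for *%R (f q)) ->
  GRing.linear_for *%R (fun v => \sum_q c q * f q v).
Proof.
move=> fl a u v; rewrite /= mulr_sumr -big_split; apply: eq_bigr => q _.
by rewrite fl /=; ring.
Qed.

Lemma biscalar_comb (n : nat) (c : 'I_n -> R) (f : 'I_n -> {biscalar V}) :
  bilinear_for (GRing.Scale.Law.clone _ _ ( *%R ) _)
    (GRing.Scale.Law.clone _ _ ( *%R ) _) (fun u v => \sum_q c q * f q u v).
Proof.
split=> [w|w]; apply: scalar_comb => q a u v.
  by rewrite linearPl.
by rewrite linearPr.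
Qed.

HB.instance Definition _ (l : sep_linear V P) mu :=
  GRing.isLinear.Build R V R *%R (slin l mu)
    (scalar_comb (fun q => slin_coef q mu) (fun q a u v => linearP (slin_comp q) a u v)).

HB.instance Definition _ D (l : sep_linear V P) i mu :=
  GRing.isLinear.Build R V R *%R (d_slin D l i mu)
    (scalar_comb (fun q => partial D (slin_coef q) i mu)
       (fun q a u v => linearP (slin_comp q) a u v)).

HB.instance Definition _ (b : sep_bilinear V P) mu :=
  bilinear_isBilinear.Build R V V R _ _ (sbil b mu)
    (biscalar_comb (fun q => sbil_coef q mu) (@sbil_comp _ _ _ b)).

HB.instance Definition _ D (b : sep_bilinear V P) i mu :=
  bilinear_isBilinear.Build R V V R _ _ (d_sbil D b i mu)
    (biscalar_comb (fun q => partial D (sbil_coef q) i mu) (@sbil_comp _ _ _ b)).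

Variable M : problem V P.

HB.instance Definition _ mu := Bilinear.copy (a_ M mu) (sbil (form_a M) mu).
HB.instance Definition _ mu := Bilinear.copy (k_ M mu) (sbil (form_k M) mu).
HB.instance Definition _ mu := GRing.Linear.copy (l_ M mu) (slin (form_l M) mu).
HB.instance Definition _ mu := GRing.Linear.copy (j_ M mu) (slin (form_j M) mu).
HB.instance Definition _ i mu :=
  Bilinear.copy (da_ M i mu) (d_sbil (params M) (form_a M) i mu).
HB.instance Definition _ i mu :=
  Bilinear.copy (dk_ M i mu) (d_sbil (params M) (form_k M) i mu).
HB.instance Definition _ i mu :=
  GRing.Linear.copy (dl_ M i mu) (d_slin (params M) (form_l M) i mu).
HB.instance Definition _ i mu :=
  GRing.Linear.copy (dj_ M i mu) (d_slin (params M) (form_j M) i mu).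

Lemma res_pr_scalar mu u : GRing.linear_for *%R (res_pr M mu u).
Proof.
move=> a v w; rewrite /res_pr linearP linearPr/=; ring.
Qed.

Lemma res_du_scalar mu u p : GRing.linear_for *%R (res_du M mu u p).
Proof.
move=> a v w; rewrite /res_du linearP !linearPl/=; ring.
Qed.

HB.instance Definition _ mu u :=
  GRing.isLinear.Build R V R *%R (res_pr M mu u) (res_pr_scalar mu u).
HB.instance Definition _ mu u p :=
  GRing.isLinear.Build R V R *%R (res_du M mu u p) (res_du_scalar mu u p).

End SeparableForms.

(** * A posteriori bounds at a fixed parameter *)

Section ErrorBounds.
Variables (R : realType) (V : normedModType R) (P : nat) (dot : {biscalar V}).
Hypotheses (dot_sym : Defs.symmetric_form dot)
  (norm_dot : forall v, `|v| ^+ 2 = dot v v).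
Variables (M : problem V P) (assumptions : standing_assumptions M).
Variables (Vh : set V) (Vh_fin : finite_dim_subspace Vh).
Variables (mu : 'rV[R]_P) (mu_in : params M mu).
Variables (ur pr : 'rV[R]_P -> V).
Hypotheses (Vh_ur : Vh (ur mu)) (Vh_pr : Vh (pr mu)).

Let Vh_lin := finite_dim_linear Vh_fin.
Let bilin_le := @bilin_norm_le R V dot dot_sym norm_dot Vh Vh_fin.
Let lin_le := @dual_norm_le R V dot dot_sym norm_dot Vh Vh_fin.
Let a_coer := a_coercive assumptions mu_in.
Let alphaV_ge0 : 0 <= (alpha M Vh mu)^-1.
Proof. by rewrite invr_ge0; exact: coercivity_constant_ge0. Qed.

Local Notation Dpr := (Delta_pr M Vh ur mu).
Local Notation Ddu := (Delta_du M Vh ur pr mu).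

Lemma Delta_pr_ge0 : 0 <= Dpr.
Proof. by rewrite mulr_ge0// dual_norm_ge0. Qed.

Lemma Delta_du_ge0 : 0 <= Ddu.
Proof.
rewrite mulr_ge0// addr_ge0 ?dual_norm_ge0// mulr_ge0 ?Delta_pr_ge0//.
by rewrite mulr_ge0// bilin_norm_ge0.
Qed.

(** Tested with the error, the residual of [ur mu] is the energy of the error. *)
Lemma primal_error uh : primal_solution M Vh mu uh -> `|uh - ur mu| <= Dpr.
Proof.
move=> [Vuh uhP]; have We := linear_subspaceB Vh_lin Vuh Vh_ur.
apply: (coercive_bound a_coer) => //; first exact: dual_norm_ge0.
apply: le_trans (lin_le (res_pr M mu (ur mu)) We).
rewrite (biscalarBl (a_ M mu)) /= uhP//; exact: ler_norm.
Qed.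

(** The full dual equation contains [uh] where the reduced residual contains [ur mu]; this mismatch
    is the source of the [k_] term in [Delta_du]. *)
Lemma dual_error uh ph : primal_solution M Vh mu uh ->
  dual_solution M Vh mu uh ph -> `|ph - pr mu| <= Ddu.
Proof.
move=> uh_sol [Vph phP]; have Wp := linear_subspaceB Vh_lin Vph Vh_pr.
have [Vuh _] := uh_sol; have Wu := linear_subspaceB Vh_lin Vuh Vh_ur.
apply: (coercive_bound a_coer) => //.
  rewrite addr_ge0 ?dual_norm_ge0// mulr_ge0 ?Delta_pr_ge0//.
  by rewrite mulr_ge0// bilin_norm_ge0.
rewrite /=; set e := ph - pr mu in Wp *.
have -> : a_ M mu e e = 2 * k_ M mu e (uh - ur mu) + res_du M mu (ur mu) (pr mu) e.
  by rewrite {2}/e (biscalarBr (a_ M mu)) (biscalarBr (k_ M mu)) /= phP// /res_du; ring.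
rewrite (le_trans (ler_norm _))// (le_trans (ler_normD _ _))//.
rewrite [X in _ <= X]mulrDl lerD//; last first.
  exact: (lin_le (res_du M mu (ur mu) (pr mu))).
rewrite normrM ger0_norm// -[X in _ <= X]mulrA -[X in _ <= X]mulrA ler_wpM2l//.
apply: (le_trans (bilin_le (k_ M mu) Wp Wu)).
by rewrite ler_wpM2l ?bilin_norm_ge0// mulrC ler_wpM2r// primal_error.
Qed.

Lemma z_bound (S : set V) z : S `<=` Vh -> z_solution M S mu (ur mu) z -> `|z| <= Dpr.
Proof.
move=> SV [Sz zP]; apply: (coercive_bound a_coer); [exact: SV|exact: dual_norm_ge0|].
apply: le_trans (lin_le (res_pr M mu (ur mu)) (SV _ Sz)).
by rewrite /= zP// -normrN ler_norm.
Qed.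

(** The data of [w] are the dual residual and [2 k(z, .)]; as [z] obeys the bound of the primal
    error, the sum is again [Delta_du]. *)
Lemma w_bound (S S' : set V) z w : S `<=` Vh -> S' `<=` Vh ->
  z_solution M S' mu (ur mu) z ->
  w_solution M S mu (ur mu) (pr mu) z w -> `|w| <= Ddu.
Proof.
move=> SV SV' z_sol [Sw wP]; have [/SV' Vz _] := z_sol.
apply: (coercive_bound a_coer); first exact: SV.
  rewrite addr_ge0 ?dual_norm_ge0// mulr_ge0 ?Delta_pr_ge0//.
  by rewrite mulr_ge0// bilin_norm_ge0.
have Vw := SV _ Sw.
rewrite /= wP// (le_trans (ler_norm _))// (le_trans (ler_normB _ _))//.
rewrite addrC [X in _ <= X]mulrDl lerD//; last first.
  exact: (lin_le (res_du M mu (ur mu) (pr mu))).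
rewrite normrM ger0_norm// -[X in _ <= X]mulrA -[X in _ <= X]mulrA ler_wpM2l//.
apply: (le_trans (bilin_le (k_ M mu) Vz Vw)).
by rewrite ler_wpM2l ?bilin_norm_ge0// ler_wpM2r// (z_bound SV').
Qed.

Lemma d_res_pr_le i v : Vh v ->
  `|d_res_pr M i mu (ur mu) v| <=
    (dual_norm Vh (dl_ M i mu) + bilin_norm Vh (da_ M i mu) * `|ur mu|) * `|v|.
Proof.
move=> Vv; rewrite (le_trans (ler_normB _ _))// [X in _ <= X]mulrDl lerD//.
  exact: (lin_le (dl_ M i mu)).
by rewrite -mulrA; exact: (bilin_le (da_ M i mu)).
Qed.

Lemma d_res_du_le i v : Vh v ->
  `|d_res_du M i mu (ur mu) (pr mu) v| <=
    (dual_norm Vh (dj_ M i mu) + 2 * bilin_norm Vh (dk_ M i mu) * `|ur mu|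
      + bilin_norm Vh (da_ M i mu) * `|pr mu|) * `|v|.
Proof.
move=> Vv; rewrite (le_trans (ler_normB _ _))// [X in _ <= X]mulrDl lerD//; last first.
  by rewrite -mulrA [_ * `|v|]mulrC; exact: (bilin_le (da_ M i mu)).
rewrite (le_trans (ler_normD _ _))// [X in _ <= X]mulrDl lerD//.
  exact: (lin_le (dj_ M i mu)).
rewrite normrM ger0_norm// -!mulrA ler_wpM2l// [`|ur mu| * _]mulrC.
exact: (bilin_le (dk_ M i mu)).
Qed.

(** An exact expansion about the reduced pair: the first-order terms carry the norms of the reduced
    solutions, and the only second-order terms are [a d q] and [k d d]. *)
Lemma inexact_gradient_error i uh ph : primal_solution M Vh mu uh ->
  dual_solution M Vh mu uh ph ->
  `|dj_ M i mu uh + dk_ M i mu uh uh + d_res_pr M i mu uh ph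
    - (dj_ M i mu (ur mu) + dk_ M i mu (ur mu) (ur mu)
       + d_res_pr M i mu (ur mu) (pr mu))| <= Delta_inexact M Vh ur pr mu 0 i.
Proof.
move=> uh_sol ph_sol; have eu := primal_error uh_sol; have ep := dual_error uh_sol ph_sol.
have [Vuh _] := uh_sol; have [Vph _] := ph_sol.
have Wu := linear_subspaceB Vh_lin Vuh Vh_ur.
have Wp := linear_subspaceB Vh_lin Vph Vh_pr.
have D0 := Delta_pr_ge0; have D0' := Delta_du_ge0.
rewrite mxE /d_res_pr.
have Vu := Vh_ur; have Vp := Vh_pr; move: eu ep Wu Wp Vu Vp.
set u := ur mu; set p := pr mu; set d := uh - u; set q := ph - p.
move=> eu ep Wu Wp Vu Vp.
rewrite (_ : uh = u + d); last by rewrite addrC subrK.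
rewrite (_ : ph = p + q); last by rewrite addrC subrK.
set j := dj_ M i mu; set k := dk_ M i mu; set a := da_ M i mu; set l := dl_ M i mu.
have -> : j (u + d) + k (u + d) (u + d) + (l (p + q) - a (u + d) (p + q))
    - (j u + k u u + (l p - a u p))
  = (k u d + k d u) + (j d - a d p) + (l q - a u q) - a d q + k d d.
  have E (f g : {scalar V}) (b c : {biscalar V}) :
      f (u + d) + b (u + d) (u + d) + (g (p + q) - c (u + d) (p + q))
      - (f u + b u u + (g p - c u p))
    = (b u d + b d u) + (f d - c d p) + (g q - c u q) - c d q + b d d.
    rewrite (linearD f) (linearD g) !(linearDl b) !(linearDr b).
    rewrite !(linearDl c) !(linearDr c) /=; ring.
  exact: E.
(* The terms [k u d] and [k d u] are bounded separately, whence the factor 2 in the estimator. *)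
have bnd (b : {biscalar V}) x y s t : Vh x -> Vh y -> `|x| <= s -> `|y| <= t ->
    `|b x y| <= bilin_norm Vh b * (s * t).
  move=> Vx Vy xs yt; apply: (le_trans (bilin_le b Vx Vy)).
  by rewrite ler_wpM2l ?bilin_norm_ge0// ler_pM.
have bndl (f : {scalar V}) x s : Vh x -> `|x| <= s -> `|f x| <= dual_norm Vh f * s.
  move=> Vx xs; apply: (le_trans (lin_le f Vx)).
  by rewrite ler_wpM2l ?dual_norm_ge0.
have := bnd k _ _ _ _ Vu Wu (lexx _) eu; have := bnd k _ _ _ _ Wu Vu eu (lexx _).
have := bndl j _ _ Wu eu; have := bnd a _ _ _ _ Wu Vp eu (lexx _).
have := bndl l _ _ Wp ep; have := bnd a _ _ _ _ Vu Wp (lexx _) ep.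
have := bnd a _ _ _ _ Wu Wp eu ep; have := bnd k _ _ _ _ Wu Wu eu eu.
rewrite /= !ler_norml => /andP[? ?] /andP[? ?] /andP[? ?] /andP[? ?] /andP[? ?].
move=> /andP[? ?] /andP[? ?] /andP[? ?].
by rewrite /j /k /a /l; apply/andP; split; lra.
Qed.

End ErrorBounds.

(** * Derivatives of the functionals along coordinate directions *)

Section Gradient.
Variables (R : realType) (V : normedModType R) (P : nat) (dot : {biscalar V}).
Hypotheses (dot_sym : Defs.symmetric_form dot)
  (norm_dot : forall v, `|v| ^+ 2 = dot v v).
Variables (M : problem V P) (assumptions : standing_assumptions M).
Variables (Vh : set V) (Vh_fin : finite_dim_subspace Vh).

Let Vh_lin := finite_dim_linear Vh_fin.

Lemma coercive_positive mu : params M mu -> positive_definite (a_ M mu).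
Proof.
move=> mu_in v v0; have [c c0 cP] := a_coercive assumptions mu_in.
by apply: lt_le_trans (cP v); rewrite mulr_gt0// exprn_gt0// normr_gt0.
Qed.

(** The full order dual solution has to be constructed: [a_] is an inner product on [Vh], and the
    representers of [j_] and of [k_] at [u] are combined. *)
Lemma dual_solution_exists mu u : params M mu -> exists p, dual_solution M Vh mu u p.
Proof.
move=> mu_in; have a_sym := a_symmetric assumptions mu_in.
have a_pos := coercive_positive mu_in.
have [p1 V1 p1P] := riesz_finite_dim a_sym a_pos (j_ M mu) Vh_fin.
have [p2 V2 p2P] := riesz_finite_dim a_sym a_pos ((k_ M mu : {biscalar V}) u) Vh_fin.
exists (2 *: p2 + p1); split; first exact: linear_subspaceP.
move=> q Vq; rewrite a_sym linearPl/= p1P// p2P// addrC.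
by rewrite (k_symmetric assumptions mu_in).
Qed.

Section Direction.
Variables (mu : 'rV[R]_P) (mu_in : params M mu) (i : 'I_P).
Local Notation shift h := (mu + h *: delta_mx 0 i).
Local Notation F := (increments (params M) i mu).

Section Interior.
Hypothesis nondeg : exists2 h : R, h != 0 & params M (shift h).

Let FF : ProperFilter F.
Proof. by case: nondeg => h h0 Dh; exact: (box_increments_proper mu_in h0 Dh). Qed.

Let F0 : h @[h --> F] --> (0 : R). Proof. exact: increments_cvg0. Qed.
Let F_neq0 : \forall h \near F, h != 0. Proof. exact: increments_neq0. Qed.
Let F_params : \forall h \near F, params M (shift h).
Proof. exact: near_withinT. Qed.

Lemma bounded_form_Vh (b : {biscalar V}) : bounded_form Vh b.
Proof. exact: (bounded_biscalar dot_sym norm_dot b Vh_fin). Qed.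

Lemma bounded_functional_Vh (f : {scalar V}) : bounded_functional Vh f.
Proof. exact: (bounded_scalar dot_sym norm_dot f Vh_fin). Qed.

Lemma sbil_deriv (b : sep_bilinear V P) :
  (forall q, twice_differentiable_on (params M) (@sbil_coef _ _ _ b q)) ->
  bil_deriv F Vh (fun h => sbil b (shift h)) (sbil b mu) (d_sbil (params M) b i mu).
Proof.
move=> bD; apply: (@uderiv_separable _ F _ _ _ _ _ _ (fun q h => sbil_coef q (shift h))
  (fun q => sbil_coef q mu) _ (fun q t => @sbil_comp _ _ _ b q t.1 t.2)).
- by move=> t; exact: mulr_ge0.
- by move=> q; apply: cvg_partial => //; case: (bD q).
- move=> q; have [C C0 CP] := bounded_form_Vh (sbil_comp q).
  by exists C => // t [V1 V2]; exact: CP.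
Qed.

Lemma slin_deriv (l : sep_linear V P) :
  (forall q, twice_differentiable_on (params M) (@slin_coef _ _ _ l q)) ->
  lin_deriv F Vh (fun h => slin l (shift h)) (slin l mu) (d_slin (params M) l i mu).
Proof.
move=> lD; apply: (@uderiv_separable _ F _ _ _ _ _ _ (fun q h => slin_coef q (shift h))
  (fun q => slin_coef q mu) _ (fun q t => @slin_comp _ _ _ l q t)).
- by [].
- by move=> q; apply: cvg_partial => //; case: (lD q).
- by move=> q; exact: bounded_functional_Vh.
Qed.

Let k_deriv := sbil_deriv (k_twice_diff assumptions).
Let j_deriv := slin_deriv (j_twice_diff assumptions).

Lemma sbil_lipschitz (b : sep_bilinear V P) :
  (forall q, twice_differentiable_on (params M) (@sbil_coef _ _ _ b q)) ->
  exists2 C, 0 <= C & \forall h \near F, forall u v, Vh u -> Vh v ->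
    `|sbil b (shift h) u v - sbil b mu u v| <= C * `|h| * (`|u| * `|v|).
Proof.
move=> bD; have [Cd Cd0 CdP] := bounded_form_Vh (d_sbil (params M) b i mu).
have [|C C0 CP] := uderiv_lipschitz F_neq0 (sbil_deriv bD) Cd0.
  by move=> t [V1 V2]; exact: CdP.
by exists C => //; apply: filterS CP => h CP u v Vu Vv; exact: (CP (u, v)).
Qed.

Lemma slin_lipschitz (l : sep_linear V P) :
  (forall q, twice_differentiable_on (params M) (@slin_coef _ _ _ l q)) ->
  exists2 C, 0 <= C & \forall h \near F, forall v, Vh v ->
    `|slin l (shift h) v - slin l mu v| <= C * `|h| * `|v|.
Proof.
move=> lD; have [Cd Cd0 CdP] := bounded_functional_Vh (d_slin (params M) l i mu).
exact: (uderiv_lipschitz F_neq0 (slin_deriv lD) Cd0 CdP).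
Qed.

Lemma primal_curve (S : set V) (u : 'rV[R]_P -> V) :
  linear_subspace S -> S `<=` Vh ->
  (forall nu, params M nu -> primal_solution M S nu (u nu)) ->
  curve F Vh (fun h => u (shift h)) (u mu).
Proof.
move=> S_lin SV uP; have [c c0 ac] := a_coercive assumptions mu_in.
have [Ca Ca0 aC] := sbil_lipschitz (a_twice_diff assumptions).
have [Cl Cl0 lC] := slin_lipschitz (l_twice_diff assumptions).
apply: (galerkin_curve F0 S_lin SV c0 (a := a_ M mu) ac Ca0 aC Cl0 lC).
- by case: (uP _ mu_in).
- move=> q Sq; have [_ up] := uP _ mu_in.
  by rewrite /= (a_symmetric assumptions mu_in); exact: up.
- apply: filterS F_params => h Dh; have [Su up] := uP _ Dh; split=> // q Sq.
  by rewrite (a_symmetric assumptions Dh : forall u v, sbil _ _ u v = _); exact: up.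
Qed.

(** The right-hand side varies through [j_], through [k_] at the moving state, and through the state
    itself; the constant has one part for each. *)
Lemma dual_rhs_lipschitz (u : R -> V) u0 : curve F Vh u u0 ->
  exists2 C, 0 <= C & \forall h \near F, forall v, Vh v ->
    `|j_ M (shift h) v + 2 * k_ M (shift h) v (u h)
      - (j_ M mu v + 2 * k_ M mu v u0)| <= C * `|h| * `|v|.
Proof.
move=> cu; have uB := curve_bounded F0 cu; case: cu => Vu0 Vuh [Cu Cu0 uC].
have [Cj Cj0 jC] := slin_lipschitz (j_twice_diff assumptions).
have [Ck Ck0 kC] := sbil_lipschitz (k_twice_diff assumptions).
have [C C0 CP] := bounded_form_Vh (k_ M mu).
exists (Cj + 2 * (Ck * (`|u0| + 1) + C * Cu)).
  by rewrite !addr_ge0 ?mulr_ge0 ?addr_ge0 ?mulr_ge0 ?addr_ge0.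
near=> h; have Vh' : Vh (u h) by near: h.
have h1 : forall v, Vh v ->
    `|j_ M (shift h) v - j_ M mu v| <= Cj * `|h| * `|v| by near: h.
have h2 : forall v w, Vh v -> Vh w ->
    `|k_ M (shift h) v w - k_ M mu v w| <= Ck * `|h| * (`|v| * `|w|) by near: h.
have h3 : `|u h| <= `|u0| + 1 by near: h; exact: uB.
have h4 : `|u h - u0| <= Cu * `|h| by near: h; exact: uC.
move=> v Vv; have h5 := CP _ _ Vv (linear_subspaceB Vh_lin Vh' Vu0).
rewrite (_ : _ - _ = (j_ M (shift h) v - j_ M mu v)
  + 2 * (k_ M (shift h) v (u h) - k_ M mu v (u h)) + 2 * k_ M mu v (u h - u0)); last first.
  by rewrite (biscalarBr (k_ M mu)) /=; ring.
rewrite (le_trans (ler_normD _ _))//.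
rewrite (_ : _ * `|h| * `|v| = Cj * `|h| * `|v| + 2 * (Ck * `|h| * (`|v| * (`|u0| + 1)))
   + 2 * (C * (`|v| * (Cu * `|h|)))); last by ring.
rewrite lerD//.
  rewrite (le_trans (ler_normD _ _))// lerD ?h1// normrM ger0_norm// ler_wpM2l//.
  by rewrite (le_trans (h2 _ _ Vv Vh'))// ler_wpM2l ?mulr_ge0// ler_wpM2l.
by rewrite normrM ger0_norm// ler_wpM2l// (le_trans h5)// ler_wpM2l// ler_wpM2l.
Unshelve. all: by end_near. Qed.

Lemma dual_curve (S : set V) (u p : 'rV[R]_P -> V) :
  linear_subspace S -> S `<=` Vh ->
  curve F Vh (fun h => u (shift h)) (u mu) ->
  (forall nu, params M nu -> dual_solution M S nu (u nu) (p nu)) ->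
  curve F Vh (fun h => p (shift h)) (p mu).
Proof.
move=> S_lin SV cu pP; have [c c0 ac] := a_coercive assumptions mu_in.
have [Ca Ca0 aC] := sbil_lipschitz (a_twice_diff assumptions).
have [Cf Cf0 fC] := dual_rhs_lipschitz cu.
apply: (galerkin_curve F0 S_lin SV c0 (a := a_ M mu) ac Ca0 aC Cf0 fC).
- by case: (pP _ mu_in).
- by case: (pP _ mu_in).
- by apply: filterS F_params => h Dh; case: (pP _ Dh).
Qed.

Lemma d_costE_interior u : Vh u ->
  d_cost M i u mu = partial (params M) (Theta M) i mu + dj_ M i mu u + dk_ M i mu u u.
Proof.
move=> Vu; apply: (partial_val FF nondeg).
(* In [d_cost] the state is frozen, so the results on curves are used for a constant one. *)
have cu : curve F Vh (fun=> u) u by exact: curve_cst.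
have c1 := lin_deriv_cvg F0 Vh_lin j_deriv (bounded_functional_Vh (dj_ M i mu)) cu.
have c2 := bil_deriv_cvg F0 Vh_lin k_deriv (bounded_form_Vh (dk_ M i mu)) cu cu.
have [TD _] := Theta_twice_diff assumptions.
apply: eq_near_cvg (cvgD (cvgD (cvg_partial FF nondeg mu_in TD) (c1 _)) (c2 _)).
by apply: filterE => h; rewrite !functions.fctE /cost /j_ /k_; ring.
Qed.

End Interior.

(** In a direction where the two bounds of the box coincide every derivative takes its default 0, so
    both sides of each derivative formula vanish. *)
Lemma partial_degenerate f : ~ (exists2 h : R, h != 0 & params M (shift h)) ->
  partial (params M) f i mu = 0.
Proof. by move=> nd; rewrite /partial asboolF. Qed.

Lemma d_slin_degenerate (l : sep_linear V P) v :
  ~ (exists2 h : R, h != 0 & params M (shift h)) ->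
  d_slin (params M) l i mu v = 0.
Proof. by move=> nd; apply: big1 => q _; rewrite partial_degenerate// mul0r. Qed.

Lemma d_sbil_degenerate (b : sep_bilinear V P) u v :
  ~ (exists2 h : R, h != 0 & params M (shift h)) ->
  d_sbil (params M) b i mu u v = 0 :> R.
Proof. by move=> nd; apply: big1 => q _; rewrite partial_degenerate// mul0r. Qed.

Lemma d_costE u : Vh u ->
  d_cost M i u mu = partial (params M) (Theta M) i mu + dj_ M i mu u + dk_ M i mu u u.
Proof.
move=> Vu; have [nd|nd] := pselect (exists2 h : R, h != 0 & params M (shift h)).
  exact: d_costE_interior.
by rewrite /d_cost /dj_ /dk_ !partial_degenerate// d_slin_degenerate//
  d_sbil_degenerate// !addr0.
Qed.

(** Letting [f] be any function that agrees with the corrected functional on the box covers the full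
    order functional too, whose correction vanishes there. *)
Lemma ncd_partial (f : 'rV[R]_P -> R) (Vpr Vdu : set V) (ur pr : 'rV[R]_P -> V) z w :
  linear_subspace Vpr -> linear_subspace Vdu -> Vpr `<=` Vh -> Vdu `<=` Vh ->
  (forall nu, params M nu -> primal_solution M Vpr nu (ur nu)) ->
  (forall nu, params M nu -> dual_solution M Vdu nu (ur nu) (pr nu)) ->
  z_solution M Vdu mu (ur mu) z ->
  w_solution M Vpr mu (ur mu) (pr mu) z w ->
  (forall nu, params M nu -> f nu = ncd_reduced_cost M ur pr nu) ->
  partial (params M) f i mu =
    d_cost M i (ur mu) mu + d_res_pr M i mu (ur mu) (pr mu + w)
    - d_res_du M i mu (ur mu) (pr mu) z.
Proof.
move=> prL duL prV duV urP prP [Vz zP] [Vw wP] fE.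
have [nd|nd] := pselect (exists2 h : R, h != 0 & params M (shift h)); last first.
  rewrite /d_cost /d_res_pr /d_res_du /dj_ /dk_ /dl_ /da_ !partial_degenerate//.
  by rewrite !d_slin_degenerate// !d_sbil_degenerate// mulr0 !subr0 !addr0 subr0.
have FF : ProperFilter F.
  by case: nd => h h0 Dh; exact: (box_increments_proper mu_in h0 Dh).
have F0 : h @[h --> F] --> (0 : R) by exact: increments_cvg0.
have F_neq0 : \forall h \near F, h != 0 by exact: increments_neq0.
have F_params : \forall h \near F, params M (shift h) by exact: near_withinT.
have cu := primal_curve nd prL prV urP.
have cp := dual_curve nd duL duV cu prP.
have [Vu uP] := urP _ mu_in; have [Vp pP] := prP _ mu_in.
rewrite d_costE; last exact: prV.
apply: (partial_val FF nd).
have [TD _] := Theta_twice_diff assumptions.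
have FF' : Filter F by exact: increments_filter.
apply: eq_near_cvg (ncd_derivative F0 F_neq0 Vh_lin
  (bounded_form_Vh (a_ M mu)) (bounded_form_Vh (k_ M mu))
  (bounded_form_Vh (da_ M i mu)) (bounded_form_Vh (dk_ M i mu))
  (bounded_functional_Vh (dl_ M i mu)) (bounded_functional_Vh (dj_ M i mu))
  (cvg_partial FF nd mu_in TD) (sbil_deriv nd (a_twice_diff assumptions))
  (sbil_deriv nd (k_twice_diff assumptions))
  (slin_deriv nd (l_twice_diff assumptions))
  (slin_deriv nd (j_twice_diff assumptions))
  (k_symmetric assumptions mu_in) prL duL prV duV cu cp Vu uP _ Vp pP _ Vz zP Vw wP).
- apply: filterS F_params => h Dh; by rewrite !fE.
- by apply: filterS F_params => h Dh; case: (urP _ Dh).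
- by apply: filterS F_params => h Dh; case: (prP _ Dh).
Qed.

End Direction.
End Gradient.

(** * The full order gradient and the two estimates *)

Lemma dot_biscalar (R : realType) (V : normedModType R) (dot : {dot V for idfun}) :
  exists2 b : {biscalar V}, Defs.symmetric_form b & forall u v, b u v = dot u v.
Proof.
(* For the identity involution sesquilinear means bilinear, and the hermitian law with sign exponent
   0 is symmetry. *)
exists (dot : Bilinear.type V V *%R *%R) => // u v.
by rewrite [LHS](hermC dot) expr0 mul1r.
Qed.

Lemma enorm2_le (R : realType) (P : nat) (x y : 'rV[R]_P) :
  (forall i, `|x 0 i| <= y 0 i) -> enorm2 x <= enorm2 y.
Proof.
move=> xy; rewrite ler_wsqrtr//; apply: ler_sum => i _.
rewrite -[x 0 i ^+ 2]real_normK ?num_real// ler_sqr ?nnegrE//.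
exact: le_trans (xy i).
Qed.

Section Gradients.
Variables (R : realType) (V : normedModType R) (P : nat) (dot : {biscalar V}).
Hypotheses (dot_sym : Defs.symmetric_form dot)
  (norm_dot : forall v, `|v| ^+ 2 = dot v v).
Variables (M : problem V P) (assumptions : standing_assumptions M).
Variables (Vh : set V) (Vh_fin : finite_dim_subspace Vh).

Lemma full_order_gradient (uh : 'rV[R]_P -> V) mu :
  params M mu -> (forall nu, params M nu -> primal_solution M Vh nu (uh nu)) ->
  exists2 ph, dual_solution M Vh mu (uh mu) ph &
    forall i, partial (params M) (reduced_cost M uh) i mu =
      d_cost M i (uh mu) mu + d_res_pr M i mu (uh mu) ph.
Proof.
move=> mu_in uhP; have Vh_lin := finite_dim_linear Vh_fin.
have V0 := linear_subspace0 Vh_lin.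
(* The derivative formula uses dual solutions at all parameters of the box, so a whole map is
   selected; its values off the box are arbitrary. *)
have pex nu : exists p, params M nu -> dual_solution M Vh nu (uh nu) p.
  have [nu_in|//] := pselect (params M nu); last by exists 0.
  by have [p pP] := dual_solution_exists assumptions Vh_fin (uh nu) nu_in; exists p.
have [ph phP] := choice pex.
have res0 nu q : params M nu -> Vh q -> res_pr M nu (uh nu) q = 0.
  by move=> nu_in Vq; have [_ up] := uhP _ nu_in; rewrite /res_pr up// subrr.
exists (ph mu) => [|i]; first exact: phP.
rewrite (ncd_partial dot_sym norm_dot assumptions Vh_fin mu_in (z := 0) (w := 0)
  i Vh_lin Vh_lin (fun _ => id) (fun _ => id) uhP phP).
- by rewrite addr0 /d_res_du (linear0 (dj_ M i mu)) (linear0l (dk_ M i mu))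
    (linear0l (da_ M i mu)) mulr0 addr0 !subr0.
- by split=> // q Vq; rewrite (linear0l (a_ M mu)) res0// oppr0.
- split=> // v Vv; rewrite (linear0r (a_ M mu)) (linear0l (k_ M mu)) mulr0 subr0.
  by have [_ pP] := phP _ mu_in; rewrite /res_du pP// subrr.
- move=> nu nu_in; rewrite /ncd_reduced_cost res0// ?addr0//.
  by case: (phP _ nu_in).
Qed.

End Gradients.

Theorem proposition2p7 (R : realType) (P : nat)
    (V : completeNormedModType R) (dot : {dot V for idfun})
    (norm_dot : forall v : V, `|v| ^+ 2 = dot v v)
    (M : problem V P) (assumptions : standing_assumptions M)
    (Vh Vpr Vdu : set V)
    (Vh_fin : finite_dim_subspace Vh)
    (Vpr_lin : linear_subspace Vpr) (Vpr_sub : Vpr `<=` Vh)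
    (Vdu_lin : linear_subspace Vdu) (Vdu_sub : Vdu `<=` Vh)
    (uh ur pr zr wr : 'rV[R]_P -> V)
    (uh_sol : forall nu, params M nu -> primal_solution M Vh nu (uh nu))
    (ur_sol : forall nu, params M nu -> primal_solution M Vpr nu (ur nu))
    (pr_sol : forall nu, params M nu -> dual_solution M Vdu nu (ur nu) (pr nu))
    (zr_sol : forall nu, params M nu -> z_solution M Vdu nu (ur nu) (zr nu))
    (wr_sol : forall nu, params M nu ->
       w_solution M Vpr nu (ur nu) (pr nu) (zr nu) (wr nu))
    (mu : 'rV[R]_P) (mu_in : params M mu) :
  enorm2 (gradient (params M) (reduced_cost M uh) mu
          - inexact_gradient M ur pr mu)
    <= enorm2 (Delta_inexact M Vh ur pr mu)
  /\
  (gradient (params M) (ncd_reduced_cost M ur pr) mu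
     = adjoint_gradient M ur pr zr wr mu
   /\
   enorm2 (gradient (params M) (reduced_cost M uh) mu
           - gradient (params M) (ncd_reduced_cost M ur pr) mu)
     <= enorm2 (Delta_ncd M Vh ur pr mu)).
Proof.
have [ip ip_sym ip_dot] := dot_biscalar dot.
have norm_ip v : `|v| ^+ 2 = ip v v by rewrite ip_dot.
have [ph ph_sol grad_h] := full_order_gradient ip_sym norm_ip assumptions Vh_fin mu_in uh_sol.
have Vur : Vh (ur mu) by apply: Vpr_sub; case: (ur_sol _ mu_in).
have Vpr' : Vh (pr mu) by apply: Vdu_sub; case: (pr_sol _ mu_in).
have Vuh : Vh (uh mu) by case: (uh_sol _ mu_in).
have z_sol := zr_sol _ mu_in; have w_sol := wr_sol _ mu_in.
have Vz : Vh (zr mu) by apply: Vdu_sub; case: z_sol.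
have Vw : Vh (wr mu) by apply: Vpr_sub; case: w_sol.
have err i : `|partial (params M) (reduced_cost M uh) i mu -
    (d_cost M i (ur mu) mu + d_res_pr M i mu (ur mu) (pr mu))|
    <= Delta_inexact M Vh ur pr mu 0 i.
  apply: le_trans (inexact_gradient_error ip_sym norm_ip assumptions Vh_fin mu_in
    Vur Vpr' i (uh_sol _ mu_in) ph_sol).
  (* Both cost derivatives contain the same derivative of [Theta], which cancels. *)
  rewrite grad_h !(d_costE ip_sym norm_ip assumptions Vh_fin mu_in i)//.
  by rewrite le_eqVlt; apply/orP; left; apply/eqP; congr (`|_|); ring.
have grad_r i : partial (params M) (ncd_reduced_cost M ur pr) i mu =
    d_cost M i (ur mu) mu + d_res_pr M i mu (ur mu) (pr mu + wr mu)
    - d_res_du M i mu (ur mu) (pr mu) (zr mu).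
  exact: (ncd_partial ip_sym norm_ip assumptions Vh_fin mu_in i Vpr_lin Vdu_lin
    Vpr_sub Vdu_sub ur_sol pr_sol z_sol w_sol).
split; first by apply: enorm2_le => i; rewrite !mxE; have := err i; rewrite mxE.
split; first by apply/rowP => i; rewrite !mxE grad_r.
(* The adjoint gradient is the inexact one plus [d_res_pr] at [wr mu] minus [d_res_du] at [zr mu];
   each addition is bounded on its own. *)
apply: enorm2_le => i; rewrite !mxE grad_r.
have e1 := err i; rewrite mxE in e1.
have e2 := d_res_pr_le ip_sym norm_ip M Vh_fin Vur i Vw.
have e3 := d_res_du_le ip_sym norm_ip M Vh_fin Vur Vpr' i Vz.
have e4 := z_bound ip_sym norm_ip assumptions Vh_fin mu_in Vdu_sub z_sol.
have e5 := w_bound ip_sym norm_ip assumptions Vh_fin mu_in Vpr_sub Vdu_sub z_sol w_sol.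
have -> : d_res_pr M i mu (ur mu) (pr mu + wr mu) =
    d_res_pr M i mu (ur mu) (pr mu) + d_res_pr M i mu (ur mu) (wr mu).
  by rewrite /d_res_pr (linearD (dl_ M i mu)) (linearDr (da_ M i mu)) /=; ring.
have := le_trans e2 (ler_wpM2l _ e5).
have := le_trans e3 (ler_wpM2l _ e4).
set A := dual_norm Vh (dl_ M i mu) + _; set B := dual_norm Vh (dj_ M i mu) + _ + _.
(* The factor spelled out in [Delta_ncd] is [Delta_du], the bound obtained for [wr mu]. *)
rewrite [A * _ * _](_ : _ = A * Delta_du M Vh ur pr mu); last first.
  by rewrite /Delta_du /Delta_pr; ring.
have A0 : 0 <= A by rewrite addr_ge0 ?mulr_ge0 ?dual_norm_ge0 ?bilin_norm_ge0.
have B0 : 0 <= B.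
  by rewrite !addr_ge0 ?mulr_ge0 ?mulr_ge0 ?dual_norm_ge0 ?bilin_norm_ge0.
rewrite -/(Delta_pr M Vh ur mu) => /(_ B0); rewrite ler_norml => /andP[? ?].
move=> /(_ A0); rewrite ler_norml => /andP[? ?].
move: e1; rewrite -/A !ler_norml => /andP[? ?].
by apply/andP; split; lra.
Qed.
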